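(* For almost all primes $p$ and all finite extensions $K/\mathbf{Q}_p$, writing $q=q_K$, $$\zeta^{\le}_{\mathfrak{O}_K[T]/T^2}(s)=\frac{1-q^{-2s}}{(1-q^{-s})^2(1-q^{1-2s})},$$ $$\zeta^{\le}_{\mathfrak{O}_K[T]/T^3}(s)=F(q,q^{-s})\cdot\frac{1-q^{2-4s}}{(1-q^{4-5s})(1-q^{2-3s})^2(1-q^{1-2s})(1-q^{-s})},$$ where $F(X,Y)=-X^4Y^7-X^4Y^6-X^3Y^5+X^3Y^4-X^2Y^4+X^2Y^3-XY^3+XY^2+Y+1$.
   Context: $\mathfrak{O}_K$ is the valuation ring of $K$ and $q_K$ its residue field size; $\mathfrak{O}_K[T]/T^n$ is the truncated polynomial ring, viewed as an $\mathfrak{O}_K$-algebra free of rank $n$. For an $\mathfrak{O}_K$-algebra $\mathsf{A}$, $\zeta^{\le}_{\mathsf{A}}(s)=\sum_{\mathsf{U}}[\mathsf{A}:\mathsf{U}]^{-s}$, summing over $\mathfrak{O}_K$-subalgebras $\mathsf{U}$ (submodules closed under multiplication, not required to contain $1$) with $\mathsf{A}/\mathsf{U}$ finite of cardinality $[\mathsf{A}:\mathsf{U}]$. *)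

(* Defs.v *)
From HB Require Import structures.
From mathcomp Require Import all_boot all_order all_algebra.
Set Implicit Arguments. Unset Strict Implicit. Unset Printing Implicit Defensive.
Import Order.TTheory GRing.Theory Num.Theory.
Local Open Scope ring_scope.

Definition dvdR (R : comNzRingType) (a b : R) : Prop := exists c, b = a * c.

(** [R] with uniformizer [pi] is the valuation ring O_K of a finite extension
    K of Q_p: a complete discrete valuation ring of characteristic 0 whose
    residue field R/(pi) is finite of characteristic p.  (By the Cohen
    structure theorem these are exactly the rings O_K, K/Q_p finite.) *)
Definition is_padic_int_ring (p : nat) (R : idomainType) (pi : R) : Prop :=
  [/\ pi != 0 /\ pi \isn't a GRing.unit,
      (forall x : R, x != 0 -> exists (u : R) (k : nat),
          u \is a GRing.unit /\ x = u * pi ^+ k),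
      (forall m : nat, (m%:R : R) = 0 -> m = 0%N),
      dvdR pi (p%:R : R) &
      (forall a : nat -> R, (forall k, dvdR (pi ^+ k) (a k.+1 - a k)) ->
         exists L : R, forall k, dvdR (pi ^+ k) (L - a k))].

Definition residue_card (R : idomainType) (pi : R) (q : nat) : Prop :=
  exists reps : seq R,
    [/\ size reps = q,
        (forall i j, (i < q)%N -> (j < q)%N -> i <> j ->
           ~ dvdR pi (nth 0 reps i - nth 0 reps j)) &
        (forall x : R, exists2 i, (i < q)%N & dvdR pi (x - nth 0 reps i))].

(** The algebra R[T]/T^n, with elements written in the basis 1,T,..,T^(n-1)
    as row vectors; multiplication is truncated convolution. *)
Definition tmul (R : idomainType) (n : nat) (a b : 'rV[R]_n) : 'rV[R]_n :=
  \row_(k < n) \sum_(i < n) \sum_(j < n | (i + j == k)%N) a 0 i * b 0 j.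

(** U is an R-subalgebra (R-submodule closed under multiplication;
    not required to contain 1). *)
Definition is_subalg (R : idomainType) (n : nat) (U : 'rV[R]_n -> Prop) : Prop :=
  [/\ U 0,
      (forall x y, U x -> U y -> U (x + y)),
      (forall (c : R) x, U x -> U (c *: x)) &
      (forall x y, U x -> U y -> U (tmul x y))].

Definition has_index (R : idomainType) (n : nat) (U : 'rV[R]_n -> Prop) (m : nat)
  : Prop :=
  exists reps : seq 'rV[R]_n,
    [/\ size reps = m,
        (forall i j, (i < m)%N -> (j < m)%N -> i <> j ->
           ~ U (nth 0 reps i - nth 0 reps j)) &
        (forall x, exists2 i, (i < m)%N & U (x - nth 0 reps i))].

Definition subalg_count (R : idomainType) (n m N : nat) : Prop :=
  exists Us : seq ('rV[R]_n -> Prop),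
    [/\ size Us = N,
        (forall i, (i < N)%N ->
           is_subalg (nth (fun _ => False) Us i) /\
           has_index (nth (fun _ => False) Us i) m),
        (forall i j, (i < N)%N -> (j < N)%N -> i <> j ->
           exists x, ~ (nth (fun _ => False) Us i x <-> nth (fun _ => False) Us j x)) &
        (forall U, is_subalg U -> has_index U m ->
           exists2 i, (i < N)%N & forall x, U x <-> nth (fun _ => False) Us i x)].

(** zeta^<=_{R[T]/T^n}(s) = P(q^{-s}) / Q(q^{-s}) as a (formal) Dirichlet
    series: with c k = number of subalgebras of index q^k, the generating
    series sum_k c_k t^k satisfies Q(t) * (sum c_k t^k) = P(t), and there
    are no subalgebras whose index is not a power of q. *)
Definition zeta_identity (R : idomainType) (n q : nat) (P Q : {poly int}) : Prop :=
  exists c : nat -> nat,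
    [/\ (forall k, subalg_count R n (q ^ k) (c k)),
        (forall m, (forall k, m <> (q ^ k)%N) -> subalg_count R n m 0) &
        (forall k, \sum_(i < k.+1) Q`_i * (c (k - i)%N)%:Z = P`_k)].

(** Polynomials in t = q^{-s} (q appears as an integer constant). *)
Definition qP (q : nat) : {poly int} := (q%:Z)%:P.

Definition P2 (q : nat) : {poly int} := 1 - 'X^2.
Definition Q2 (q : nat) : {poly int} := (1 - 'X) ^+ 2 * (1 - qP q * 'X^2).

Definition Fpoly (q : nat) : {poly int} :=
  - qP q ^+ 4 * 'X^7 - qP q ^+ 4 * 'X^6 - qP q ^+ 3 * 'X^5 + qP q ^+ 3 * 'X^4
  - qP q ^+ 2 * 'X^4 + qP q ^+ 2 * 'X^3 - qP q * 'X^3 + qP q * 'X^2 + 'X + 1.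

Definition P3 (q : nat) : {poly int} := Fpoly q * (1 - qP q ^+ 2 * 'X^4).
Definition Q3 (q : nat) : {poly int} :=
  (1 - qP q ^+ 4 * 'X^5) * (1 - qP q ^+ 2 * 'X^3) ^+ 2 * (1 - qP q * 'X^2)
  * (1 - 'X).

(* Main.v *)
Require Import Defs.
From HB Require Import structures.
From mathcomp Require Import all_boot all_order all_algebra.
From mathcomp Require Import boolp qpoly ring zify.
Set Implicit Arguments. Unset Strict Implicit. Unset Printing Implicit Defensive.
Import Order.TTheory GRing.Theory Num.Theory.

(** A finite-index submodule of O[T]/T^3 is spanned by unique rows (pi^a, x, y),
    (0, pi^b, z), (0, 0, pi^c) with x modulo pi^b and y, z modulo pi^c.  It is
    closed under multiplication iff pi^c | pi^2b, pi^c | x pi^b, pi^b | pi^a x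
    and pi^c | pi^a y + x^2 - w z, where w = pi^a x / pi^b.  Given x of
    valuation e, the last condition is a linear congruence in (y, z) whose
    coefficients have minimal valuation min(a + e - b, c), so the number of
    solutions depends only on a, b, c, e and q; no prime has to be excluded.

    Substituting f = b - e and d = a - f turns the zeta function into the sum of
    w(f) q^(c + min(d, c)) t^(d + 2f + e + c) over all d, e, f, c >= 0 with
    c <= 2e + f and min(d, c) <= 2e, where w(f) is the number of units modulo
    pi^f.  With m = min(d, c), splitting into c <= d and d < c leaves geometric
    series, and m <= 2e is solved by m = 2i + eps, e = i + j + eps with eps = 0
    or 1.  All manipulations take place in a ring where t is nilpotent, so that
    every sum is finite. *)

(** * The generating functions modulo [t ^ K] *)

Section TruncatedSeries.
Local Open Scope ring_scope.
Variables (S : comNzRingType) (K : nat).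

(** Stands for 1/(1 - u), which it equals whenever u^K = 0. *)
Definition geom (u : S) : S := \sum_(i < K) u ^+ i.

Lemma geomP (u : S) : u ^+ K = 0 -> (1 - u) * geom u = 1.
Proof. by move=> uK; rewrite -opprB mulNr -subrX1 uK sub0r opprK. Qed.

(** As [geom u] inverts 1 - u, it suffices to telescope. When K <= N the bound i < N is void and
    u^(N+1) is zero. *)
Lemma geom_truncated (u : S) (N : nat) : u ^+ K = 0 ->
  \sum_(i < K | (i < N)%N) u ^+ i.+1 = geom u * (u - u ^+ N.+1).
Proof.
move=> uK.
suff E : (1 - u) * (\sum_(i < K | (i < N)%N) u ^+ i.+1) = u - u ^+ N.+1.
  by rewrite -E mulrA [geom u * _]mulrC geomP // mul1r.
have uge n : (K <= n)%N -> u ^+ n = 0.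
  by move=> /subnK <-; rewrite exprD uK mulr0.
case: (leqP K N) => [KN|/ltnW NK].
  rewrite (eq_bigl predT) => [|i]; last by rewrite (leq_trans _ KN).
  under eq_bigr => i _ do rewrite exprS.
  by rewrite -mulr_sumr mulrCA geomP // exprS uge // mulr0 subr0 mulr1.
rewrite -(big_ord_widen K (fun i => u ^+ i.+1) NK).
under eq_bigr => i _ do rewrite exprS.
by rewrite -mulr_sumr mulrCA -opprB mulNr -subrX1 opprB mulrBr mulr1 -exprS.
Qed.

Lemma sum_shift (F : nat -> S) (m : nat) :
  (forall n, (K <= n)%N -> F n = 0) ->
  \sum_(n < K | (m <= n)%N) F n = \sum_(n < K) F (m + n)%N.
Proof.
move=> F0.
rewrite -(big_mkord (leq m) F).
have -> : \sum_(n < K) F (m + n)%N = \sum_(0 + m <= i < K + m) F i.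
  by rewrite big_addn addnK big_mkord; apply: eq_bigr => i _; rewrite addnC.
rewrite [RHS](big_nat_widenl _ 0) // [RHS](big_cat_nat (n := K)) ?leq_addr //=.
rewrite [X in _ = _ + X]big1_seq ?addr0 // => i /andP[_].
by rewrite mem_index_iota => /andP[/F0].
Qed.

Lemma sum_even_odd (F : nat -> S) n :
  \sum_(m < n.*2) F m = \sum_(i < n) (F i.*2 + F i.*2.+1).
Proof.
elim: n => [|n IH]; first by rewrite !big_ord0.
by rewrite doubleS !big_ord_recr /= IH addrA.
Qed.

Variables (t q : S).
Hypothesis tK : t ^+ K = 0.

Lemma t_ge n : (K <= n)%N -> t ^+ n = 0.
Proof. by move=> /subnK <-; rewrite exprD tK mulr0. Qed.

Lemma texpK (u : S) j : (u * t ^+ j.+1) ^+ K = 0.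
Proof. by rewrite exprMn -exprM t_ge ?mulr0 // leq_pmull. Qed.

(** Here m = min(d, c): the first inner sum collects c = m <= d, the second d = m < c. After the
    shift the free index may again run over K values, because every added term has a power of [t] of
    exponent at least K. *)
Lemma sum_min_split (G : nat -> nat -> S) :
  \sum_(c < K) \sum_(d < K) G d c * t ^+ (d + c) =
  \sum_(m < K) (\sum_(d < K) G (m + d)%N m * t ^+ (m + d + m) +
                \sum_(c < K) G m (m.+1 + c)%N * t ^+ (m + (m.+1 + c))).
Proof.
under eq_bigr => c _ do rewrite (bigID (fun d : 'I_K => (c <= d)%N)) /=.
rewrite big_split [RHS]big_split /=; congr (_ + _).
  apply: eq_bigr => m _.
  rewrite (sum_shift (F := fun d => G d m * t ^+ (d + m))) // => n Kn.
  by rewrite t_ge ?mulr0 // (leq_trans Kn) ?leq_addr.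
rewrite (exchange_big_dep predT) //=; apply: eq_bigr => m _.
under eq_bigl => c do rewrite -ltnNge.
rewrite (sum_shift (F := fun c => G m c * t ^+ (m + c)) ) // => n Kn.
by rewrite t_ge ?mulr0 // (leq_trans Kn) ?leq_addl.
Qed.

(* At [q], the number of units modulo [pi ^ f]; the zero ring [f = 0] has one. *)
Definition unit_count (f : nat) : S := if f is f'.+1 then q ^+ f - q ^+ f' else 1.

(** For f > 0 the weight is q^f - q^(f-1), so the series is a difference of two geometric series in
    q u, the second multiplied by u. *)
Lemma sum_unit_count (u : S) : (0 < K)%N -> u ^+ K = 0 ->
  \sum_(f < K) unit_count f * u ^+ f = (1 - u) * geom (q * u).
Proof.
move=> K0 uK.
have H n : \sum_(f < n.+1) unit_count f * u ^+ f =
    \sum_(f < n.+1) (q * u) ^+ f - u * \sum_(f < n) (q * u) ^+ f.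
  elim: n => [|n IH].
    by rewrite !big_ord_recr !big_ord0 /= mulr0 subr0 mul1r.
  rewrite big_ord_recr /= IH [in RHS]big_ord_recr [X in _ = _ - u * X]big_ord_recr /=.
  rewrite !exprMn !exprS; ring.
rewrite /geom; case: K K0 uK => // n _ un; rewrite H.
rewrite mulrBl mul1r; congr (_ - _).
(* The second sum in [H] stops one term short of [geom (q * u)]; the absent term is multiplied by u,
   hence contains u^K = 0. *)
by rewrite big_ord_recr /= mulrDr exprMn mulrCA -exprS un mulr0 addr0.
Qed.

(** With m = min(a, b), each m contributes (q t^2)^m times 1/(1 - t) from b <= a and t/(1 - t) from
    a < b. *)
Lemma zeta2_series :
  (1 - t) ^+ 2 * (1 - q * t ^+ 2) *
    (\sum_(b < K) \sum_(a < K) q ^+ minn a b * t ^+ (a + b)) = 1 - t ^+ 2.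
Proof.
rewrite (sum_min_split (fun a b => q ^+ minn a b)).
have -> : \sum_(m < K) (\sum_(d < K) q ^+ minn (m + d) m * t ^+ (m + d + m) +
       \sum_(c < K) q ^+ minn m (m.+1 + c) * t ^+ (m + (m.+1 + c)))
     = geom (q * t ^+ 2) * ((1 + t) * geom t).
  rewrite /geom big_distrl /=; apply: eq_bigr => m _.
  rewrite mulrDl mul1r mulrDr !mulr_sumr; congr (_ + _); apply: eq_bigr => d _.
    rewrite (minn_idPr (leq_addr _ _)) exprMn -exprM -mulrA; congr (_ * _).
    by rewrite -exprD; congr (_ ^+ _); rewrite mul2n -addnn addnAC.
  rewrite (minn_idPl _); last by rewrite addSn -addnS leq_addr.
  rewrite exprMn -exprM -mulrA; congr (_ * _).
  by rewrite -exprS -exprD mul2n -addnn addSn addnS addnA addnS.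
transitivity ((1 - t) * geom t * ((1 - q * t ^+ 2) * geom (q * t ^+ 2)) * (1 - t ^+ 2)).
  by ring.
by rewrite !geomP ?mul1r //; exact: texpK.
Qed.

(* With f the valuation deficit b - e of x modulo [pi ^ b] and d = a - f, this
   is the number of pairs (y, z) completing (a, b, c, x) to a subalgebra. *)
Definition zeta3_weight (d e f c : nat) : S :=
  if (c <= e.*2 + f)%N && (minn d c <= e.*2)%N then q ^+ (c + minn d c) else 0.

Definition zeta3_summand (a b c : nat) : S :=
  \sum_(e < b.+1 | (b <= a + e)%N)
     unit_count (b - e) * zeta3_weight (a + e - b) e (b - e) c.

(** Substitute b = e + f and a = f + d: the constraints e <= b and b <= a + e become f >= 0 and d >=
    0, and a + b + c becomes (e + 2f) + (d + c). *)
Lemma zeta3_reindex :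
  \sum_(c < K) \sum_(b < K) \sum_(a < K) zeta3_summand a b c * t ^+ (a + b + c) =
  \sum_(e < K) \sum_(f < K) unit_count f * t ^+ (e + f.*2) *
     \sum_(c < K) \sum_(d < K) zeta3_weight d e f c * t ^+ (d + c).
Proof.
transitivity (\sum_(c < K) \sum_(e < K) \sum_(f < K) \sum_(d < K)
   unit_count f * t ^+ (e + f.*2) * (zeta3_weight d e f c * t ^+ (d + c))).
  apply: eq_bigr => c _.
  pose T a b e := if (b <= a + e)%N then
     unit_count (b - e) * zeta3_weight (a + e - b) e (b - e) c * t ^+ (a + b + c) else 0.
  transitivity (\sum_(b < K) \sum_(a < K) \sum_(e < K | (e <= b)%N) T a b e).
    apply: eq_bigr => b _; apply: eq_bigr => a _.
    rewrite /zeta3_summand mulr_suml big_mkcond /=.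
    by rewrite (big_ord_widen K (fun e => T a b e) (ltn_ord b)).
  under eq_bigr => b _ do rewrite exchange_big /=.
  rewrite (exchange_big_dep predT) //=; apply: eq_bigr => e _.
  rewrite (sum_shift (F := fun b => \sum_(a < K) T a b e)); last first.
    move=> b Kb; apply: big1 => a _; rewrite /T; case: ifP => // _.
    by rewrite t_ge ?mulr0 // addnAC (leq_trans Kb) ?leq_addl.
  apply: eq_bigr => f _.
  have -> : \sum_(a < K) T a (e + f)%N e = \sum_(a < K | (f <= a)%N) T a (e + f)%N e.
    rewrite [RHS]big_mkcond; apply: eq_bigr => a _; rewrite /T [(a + e)%N]addnC leq_add2l.
    by case: ifP.
  rewrite (sum_shift (F := fun a => T a (e + f)%N e)); last first.
    move=> a Ka; rewrite /T; case: ifP => // _.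
    by rewrite t_ge ?mulr0 // -addnA (leq_trans Ka) ?leq_addr.
  apply: eq_bigr => d _; rewrite /T.
  rewrite ifT; last by rewrite addnC leq_add2r leq_addr.
  rewrite addKn (_ : f + d + e - (e + f) = d)%N; last by rewrite addnC addnA addKn.
  rewrite -!mulrA; congr (_ * _); rewrite mulrCA; congr (_ * _); rewrite -exprD.
  by congr (_ ^+ _); rewrite -addnn; ring.
rewrite exchange_big; apply: eq_bigr => e _; rewrite exchange_big; apply: eq_bigr => f _.
by rewrite mulr_sumr; apply: eq_bigr => c _; rewrite mulr_sumr.
Qed.

(** For c <= d the bound c <= 2e + f follows from m <= 2e, so d - m is free and gives [geom t]. For
    d < c, writing c = m + 1 + c' turns the bound into c' < 2e - m + f, a truncated geometric series
    in q t. *)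
Lemma zeta3_inner e f :
  \sum_(c < K) \sum_(d < K) zeta3_weight d e f c * t ^+ (d + c) =
  \sum_(m < K | (m <= e.*2)%N) (q ^+ 2 * t ^+ 2) ^+ m *
     (geom t + geom (q * t) * (q * t - (q * t) ^+ (e.*2 - m + f).+1)).
Proof.
have qtK : (q * t) ^+ K = 0 by exact: (texpK q 0).
rewrite (sum_min_split (fun d c => zeta3_weight d e f c)) [RHS]big_mkcond /=; apply: eq_bigr => m _.
rewrite /zeta3_weight; case: (leqP m e.*2) => me; last first.
  rewrite !big1 ?addr0 // => d _.
    by rewrite (minn_idPl _) ?(ltn_geF me) ?andbF ?mul0r // addSn -addnS leq_addr.
  by rewrite (minn_idPr (leq_addr _ _)) (ltn_geF me) andbF mul0r.
rewrite mulrDr -geom_truncated // !mulr_sumr; congr (_ + _).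
  apply: eq_bigr => d _; rewrite (minn_idPr (leq_addr _ _)) me.
  rewrite ifT; last by rewrite andbT (leq_trans me) ?leq_addr.
  rewrite exprMn -!exprM -mulrA -exprD; congr (_ ^+ _ * _ ^+ _); first by rewrite mul2n addnn.
  by rewrite mul2n -addnn addnAC.
rewrite [RHS]big_mkcond; apply: eq_bigr => c _.
rewrite (minn_idPl _); last by rewrite addSn -addnS leq_addr.
rewrite me andbT addnBAC // addSn ltn_subRL.
case: ifP => _; last by rewrite mul0r.
by rewrite !exprMn !(exprD, exprS); ring.
Qed.

(** For m = 2i and e = i + j the summand is (q^4 t^5)^i (v^2 t)^j; for m = 2i + 1 and e = i + j + 1
    it has the extra factor q^2 t^3 v. It is applied with v = 1 and v = q t. *)
Lemma sum_parity (v : S) :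
  \sum_(e < K) \sum_(m < K | (m <= e.*2)%N)
     t ^+ e * (q ^+ 2 * t ^+ 2) ^+ m * v ^+ (e.*2 - m) =
  (1 + q ^+ 2 * t ^+ 3 * v) * geom (q ^+ 4 * t ^+ 5) * geom (v ^+ 2 * t).
Proof.
set p := q ^+ 2 * t ^+ 2.
have pge n : (K <= n)%N -> p ^+ n = 0.
  by move=> Kn; rewrite exprMn -!exprM [X in _ * X]t_ge ?mulr0 // (leq_trans Kn) ?leq_pmull.
pose F m := \sum_(e < K | (m <= e.*2)%N) t ^+ e * p ^+ m * v ^+ (e.*2 - m).
rewrite (exchange_big_dep predT) //=; rewrite -/(F _).
(* Doubling the range of m adds only zeros, since p^m = 0 for m >= K, and lets even and odd m be
   paired. *)
have -> : \sum_(j < K) F j = \sum_(j < K.*2) F j.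
  rewrite -addnn big_split_ord /= [X in _ = _ + X]big1 ?addr0 // => i _.
  by apply: big1 => e _; rewrite pge ?mulr0 ?mul0r // leq_addr.
rewrite sum_even_odd /geom.
rewrite -mulrA big_distrl mulr_sumr /=; apply: eq_bigr => i _.
have tv0 a : forall n, (K <= n)%N -> t ^+ n * p ^+ a * v ^+ (n.*2 - a) = 0.
  by move=> n Kn; rewrite t_ge ?mul0r.
have -> : F i.*2 = \sum_(j < K) t ^+ (i + j) * p ^+ i.*2 * v ^+ ((i + j).*2 - i.*2).
  rewrite -(sum_shift (F := fun n => t ^+ n * p ^+ i.*2 * v ^+ (n.*2 - i.*2))); last exact: tv0.
  by apply: eq_bigl => e; rewrite leq_double.
have -> : F i.*2.+1 = \sum_(j < K) t ^+ (i.+1 + j) * p ^+ i.*2.+1 * v ^+ ((i.+1 + j).*2 - i.*2.+1).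
  rewrite -(sum_shift (F := fun n => t ^+ n * p ^+ i.*2.+1 * v ^+ (n.*2 - i.*2.+1))); last exact: tv0.
  by apply: eq_bigl => e; rewrite ltn_double.
rewrite mulrDl mul1r !mulr_sumr; congr (_ + _); apply: eq_bigr => j _.
  by rewrite doubleD addKn -!muln2 /p !(exprD, exprM, exprMn); ring.
rewrite (_ : (i.+1 + j).*2 - i.*2.+1 = j.*2.+1)%N; last first.
  by rewrite doubleD doubleS !addSn subSS -addnS addKn.
by rewrite addSn (exprS t) (exprS p) (exprS v) -!muln2 /p !(exprD, exprM, exprMn); ring.
Qed.

Lemma zeta3_series : (0 < K)%N ->
  (1 - q ^+ 4 * t ^+ 5) * (1 - q ^+ 2 * t ^+ 3) ^+ 2 * (1 - q * t ^+ 2) * (1 - t) *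
  (\sum_(c < K) \sum_(b < K) \sum_(a < K) zeta3_summand a b c * t ^+ (a + b + c)) =
  (- q ^+ 4 * t ^+ 7 - q ^+ 4 * t ^+ 6 - q ^+ 3 * t ^+ 5 + q ^+ 3 * t ^+ 4
    - q ^+ 2 * t ^+ 4 + q ^+ 2 * t ^+ 3 - q * t ^+ 3 + q * t ^+ 2 + t + 1) *
  (1 - q ^+ 2 * t ^+ 4).
Proof.
move=> K0; rewrite zeta3_reindex.
pose L v := (1 + q ^+ 2 * t ^+ 3 * v) * geom (q ^+ 4 * t ^+ 5) * geom (v ^+ 2 * t).
(* The upper bound on c enters only through (q t)^(2e - m + f + 1). The part without this power is
   summed with u = t^2 and v = 1; in the other part (q t)^f joins t^(2f), which gives u = q t^3 and
   v = q t. *)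
have -> : \sum_(e < K) \sum_(f < K) unit_count f * t ^+ (e + f.*2) *
     (\sum_(c < K) \sum_(d < K) zeta3_weight d e f c * t ^+ (d + c)) =
   (geom t + geom (q * t) * (q * t)) * ((1 - t ^+ 2) * geom (q * t ^+ 2)) * L 1
   - geom (q * t) * (q * t) * ((1 - q * t ^+ 3) * geom (q * (q * t ^+ 3))) * L (q * t).
  rewrite -(sum_unit_count K0 (u := t ^+ 2)); last by rewrite -exprM t_ge // leq_pmull.
  rewrite -(sum_unit_count K0 (u := q * t ^+ 3)); last exact: texpK.
  rewrite /L -!sum_parity !mulr_sumr -sumrB; apply: eq_bigr => e _.
  under eq_bigr => f _ do rewrite zeta3_inner mulr_sumr.
  move: (geom t) (geom (q * t)) => gt g1.
  rewrite exchange_big !mulr_sumr -sumrB; apply: eq_bigr => m _.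
  rewrite !mulr_suml -sumrB; apply: eq_bigr => f _.
  rewrite expr1n [(q * t) ^+ _.+1]exprS -!muln2 !(exprD, exprM, exprMn). ring.
rewrite /L expr1n mul1r mulr1.
have -> : (q * t) ^+ 2 * t = q ^+ 2 * t ^+ 3 by ring.
have -> : q * (q * t ^+ 3) = q ^+ 2 * t ^+ 3 by ring.
have Et : (1 - t) * geom t = 1 by apply: geomP.
have E1 : (1 - q * t) * geom (q * t) = 1 by apply: geomP; exact: (texpK q 0).
have E2 : (1 - q * t ^+ 2) * geom (q * t ^+ 2) = 1 by apply: geomP; exact: texpK.
have E3 : (1 - q ^+ 2 * t ^+ 3) * geom (q ^+ 2 * t ^+ 3) = 1 by apply: geomP; exact: texpK.
have E5 : (1 - q ^+ 4 * t ^+ 5) * geom (q ^+ 4 * t ^+ 5) = 1 by apply: geomP; exact: texpK.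
set P := RHS.
move: (geom t) (geom (q * t)) (geom (q * t ^+ 2)) (geom (q ^+ 2 * t ^+ 3))
  (geom (q ^+ 4 * t ^+ 5)) Et E1 E2 E3 E5 => gt g1 g2 g3 g5 Et E1 E2 E3 E5.
(* The truncated series brought in a factor 1/(1 - q t) that the claimed denominator lacks; [Y]
   shows that it cancels, with quotient the claimed numerator. *)
have Y : (1 - q ^+ 2 * t ^+ 3) ^+ 2 * (1 + t) * (1 + q ^+ 2 * t ^+ 3) * (1 - q * t + (1 - t) * (q * t))
   - q * t * (1 - q * t ^+ 3) * (1 + q ^+ 3 * t ^+ 4) * (1 - q * t ^+ 2) * (1 - t) =
   (1 - q * t) * P by rewrite /P; ring.
transitivity (((1 - q ^+ 4 * t ^+ 5) * g5) *
  ((1 - q ^+ 2 * t ^+ 3) ^+ 2 * ((1 - q * t ^+ 2) * g2) * (1 + t) * (1 + q ^+ 2 * t ^+ 3)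
    * ((1 - t) * gt) * ((1 - t) * gt + (1 - t) * g1 * (q * t))
   - g1 * (q * t) * (1 - q * t ^+ 3) * (1 + q ^+ 3 * t ^+ 4) * (1 - q * t ^+ 2)
    * (1 - t) * ((1 - q ^+ 2 * t ^+ 3) * g3) ^+ 2)); first by ring.
have E1' : 1 + (1 - t) * g1 * (q * t) = g1 * (1 - q * t + (1 - t) * (q * t)).
  by rewrite mulrDr [g1 * (1 - _)]mulrC E1; ring.
rewrite E5 E2 E3 Et E1' expr1n !mulr1 mul1r.
transitivity (g1 * ((1 - q * t) * P)); last by rewrite mulrA [g1 * _]mulrC E1 mul1r.
by rewrite -Y; ring.
Qed.
End TruncatedSeries.

(** * From truncated identities to coefficients of power series *)

Section Coefficients.
Local Open Scope ring_scope.

Lemma in_qpolyXn_coef (R : comNzRingType) (p p' : {poly R}) (K k : nat) : (k < K)%N ->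
  in_qpoly 'X^K p = in_qpoly 'X^K p' -> p`_k = p'`_k.
Proof.
move=> kK E; have {}E : in_qpoly 'X^K (p - p') = 0 by rewrite rmorphB /= E subrr.
have := congr1 val E; rewrite /= mk_monic_Xn prednK ?(leq_ltn_trans _ kK) // => r0.
have := Pdiv.RingMonic.rdivp_eq (monicXn R K) (p - p').
rewrite r0 addr0 => /(congr1 (fun r : {poly R} => r`_k)).
by rewrite coefB coefMXn kK => /eqP; rewrite subr_eq0 => /eqP.
Qed.

(** For K = 0 the quotient is formed modulo X instead of 1, and X^0 is not zero there; hence K must
    be positive. *)
Lemma in_qpolyXn_exp (R : comNzRingType) (K : nat) : (0 < K)%N ->
  in_qpoly ('X^K : {poly R}) 'X ^+ K = 0.
Proof.
move=> K0; rewrite -rmorphXn; apply: val_inj.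
by rewrite /= mk_monic_Xn prednK // Pdiv.RingMonic.rmodpp ?monicXn.
Qed.

(** The class of X modulo X^K is nilpotent, so the truncated identities apply to it; the coefficient
    of index k is read off with K = k + 1. *)
Lemma series_identity_coef (P Q : {poly int}) (c : nat -> nat) :
  (forall K, (0 < K)%N ->
     in_qpoly 'X^K Q * (\sum_(k < K) (c k)%:R * in_qpoly 'X^K 'X ^+ k) = in_qpoly 'X^K P) ->
  forall k, \sum_(i < k.+1) Q`_i * (c (k - i)%N)%:Z = P`_k.
Proof.
move=> H k.
have E : in_qpoly 'X^(k.+1) (Q * \poly_(i < k.+1) (c i)%:Z) = in_qpoly 'X^(k.+1) P.
  rewrite -(H k.+1) // rmorphM poly_def rmorph_sum; congr (_ * _).
  by apply: eq_bigr => i _; rewrite -mul_polyC rmorphM -rmorphXn -natz !rmorph_nat.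
rewrite -(in_qpolyXn_coef (ltnSn k) E) coefM; apply: eq_bigr => i _.
by rewrite coef_poly ltnS leq_subr.
Qed.

Lemma sum_widen0 (S : nmodType) (n K : nat) (F : nat -> S) : (n <= K)%N ->
  (forall i, (n <= i)%N -> F i = 0) -> \sum_(i < n) F i = \sum_(i < K) F i.
Proof.
move=> nK F0; rewrite (big_ord_widen _ _ nK) big_mkcond; apply: eq_bigr => i _.
by case: ltnP => // /F0.
Qed.

Definition sum_by_total2 (N : nat -> nat -> nat) (k : nat) : nat :=
  (\sum_(b < k.+1) \sum_(a < k.+1 | a + b == k) N a b)%N.

Definition sum_by_total3 (N : nat -> nat -> nat -> nat) (k : nat) : nat :=
  (\sum_(c < k.+1) \sum_(b < k.+1) \sum_(a < k.+1 | a + b + c == k) N a b c)%N.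

Variables (S : comNzRingType) (t : S) (K : nat).
Hypothesis tK : t ^+ K = 0.

(** Collects terms by k = a + s. Those with a + s >= K are missing on the left and zero on the
    right. *)
Lemma sum_total (F : nat -> nat) (s : nat) :
  \sum_(k < K) (\sum_(a < k.+1 | (a + s == k)%N) F a)%N%:R * t ^+ k =
  \sum_(a < K) (F a)%:R * t ^+ (a + s).
Proof.
transitivity (\sum_(k < K) \sum_(a < K) if (a + s == k)%N then (F a)%:R * t ^+ (a + s) else 0).
  apply: eq_bigr => k _.
  rewrite natr_sum mulr_suml big_mkcond /=.
  rewrite (sum_widen0 (K := K) (F := fun a => if (a + s == k)%N then (F a)%:R * t ^+ k else 0)) //.
    by apply: eq_bigr => a _; case: eqP => // ->.
  by move=> i ki; rewrite gtn_eqF // ltn_addr.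
rewrite exchange_big; apply: eq_bigr => a _; rewrite -big_mkcond /=.
case: (ltnP (a + s) K) => asK.
  by rewrite (big_pred1 (Ordinal asK)) // => k; rewrite eq_sym.
rewrite (t_ge tK asK) mulr0; apply: big1 => k /eqP E.
by have := ltn_ord k; rewrite -E ltnNge asK.
Qed.

Lemma sum_total_empty (F : nat -> nat) (s k : nat) : (k < s)%N ->
  (\sum_(a < k.+1 | (a + s == k)%N) F a)%N = 0%N.
Proof.
move=> ks; apply: big1 => a /eqP E; exfalso.
by move: ks; rewrite -[X in (X < _)%N]E ltnNge leq_addl.
Qed.

Lemma sum_by_total2E (N : nat -> nat -> nat) :
  \sum_(k < K) (sum_by_total2 N k)%:R * t ^+ k =
  \sum_(b < K) \sum_(a < K) (N a b)%:R * t ^+ (a + b).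
Proof.
under [RHS]eq_bigr => b _ do rewrite -(sum_total (fun a => N a b)).
rewrite [RHS]exchange_big; apply: eq_bigr => k _.
rewrite /sum_by_total2 (@sum_widen0 nat _ K (fun b => \sum_(a < k.+1 | a + b == k) N a b)%N) //.
  by rewrite natr_sum mulr_suml.
by move=> b kb; rewrite (sum_total_empty (fun a => N a b)).
Qed.

Lemma sum_by_total3E (N : nat -> nat -> nat -> nat) :
  \sum_(k < K) (sum_by_total3 N k)%:R * t ^+ k =
  \sum_(c < K) \sum_(b < K) \sum_(a < K) (N a b c)%:R * t ^+ (a + b + c).
Proof.
under [RHS]eq_bigr => c _ do
 (under eq_bigr => b _ do
   (under eq_bigr => a _ do rewrite -addnA; rewrite -(sum_total (fun a => N a b c)))).
under [RHS]eq_bigr => c _ do rewrite exchange_big /=.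
rewrite [RHS]exchange_big; apply: eq_bigr => k _ /=.
(* With b + c as a single shift, [G] vanishes for b + c > k, so the ranges k + 1 and K for b and c
   give the same sum. *)
pose G c b := (\sum_(a < k.+1 | a + (b + c) == k) N a b c)%N.
have G0 b c : (k < b + c)%N -> G c b = 0%N by move=> h; rewrite /G (sum_total_empty (fun a => N a b c)).
have -> : sum_by_total3 N k = (\sum_(c < K) \sum_(b < K) G c b)%N.
  rewrite -(@sum_widen0 nat k.+1 K (fun c => \sum_(b < K) G c b)%N) //; last first.
    by move=> c kc; apply: big1 => b _; rewrite G0 // ltn_addl.
  apply: eq_bigr => c _; rewrite -(@sum_widen0 nat k.+1 K (G c)) //; last first.
    by move=> b kb; rewrite G0 // ltn_addr.
  by apply: eq_bigr => b _; apply: eq_bigl => a; rewrite addnA.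
by rewrite natr_sum mulr_suml; apply: eq_bigr => c _; rewrite natr_sum mulr_suml.
Qed.

End Coefficients.

(** * Coefficient identities for the two zeta functions *)

Section ZetaSeries.
Local Open Scope ring_scope.
Variables (q : nat) (q_gt0 : (0 < q)%N).

Lemma qPE : qP q = q%:R.
Proof. by rewrite /qP -natz rmorph_nat. Qed.

Lemma zeta2_coef (k : nat) :
  \sum_(i < k.+1) (Q2 q)`_i * (sum_by_total2 (fun a b => q ^ minn a b)%N (k - i)%N)%:Z = (P2 q)`_k.
Proof.
apply: series_identity_coef => K K0.
set t := in_qpoly 'X^K 'X; have tK : t ^+ K = 0 by exact: in_qpolyXn_exp.
rewrite sum_by_total2E // /Q2 /P2 qPE.
rewrite !(rmorphM, rmorphB, rmorphXn, rmorph1, rmorph_nat) -/t.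
rewrite -(zeta2_series q%:R tK); congr (_ * _).
by apply: eq_bigr => b _; apply: eq_bigr => a _; rewrite natrX.
Qed.

Definition unit_countn (f : nat) : nat := if f is f'.+1 then q ^ f - q ^ f' else 1%N.

Lemma unit_countnE (S : comNzRingType) f : (unit_countn f)%:R = unit_count (q%:R : S) f.
Proof. by case: f => // f; rewrite /= natrB ?natrX // leq_pexp2l. Qed.

(** The factors of the term at e count the x of truncated valuation e and, for each such x, the
    admissible pairs (z, y). *)
Definition zeta3_count (a b c : nat) : nat :=
  (\sum_(e < b.+1 | [&& b <= a + e, c <= b + e & minn (a + e - b) c <= e.*2])
     unit_countn (b - e) * q ^ (c + minn (a + e - b) c))%N.

Lemma zeta3_coef (k : nat) :
  \sum_(i < k.+1) (Q3 q)`_i * (sum_by_total3 zeta3_count (k - i)%N)%:Z = (P3 q)`_k.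
Proof.
apply: series_identity_coef => K K0.
set t := in_qpoly 'X^K 'X; have tK : t ^+ K = 0 by exact: in_qpolyXn_exp.
rewrite sum_by_total3E // /Q3 /P3 /Fpoly qPE.
rewrite !(rmorphM, rmorphB, rmorphN, rmorphD, rmorphXn, rmorph1, rmorph_nat) -/t.
rewrite -(zeta3_series q%:R tK) //; congr (_ * _).
apply: eq_bigr => c _; apply: eq_bigr => b _; apply: eq_bigr => a _; congr (_ * _).
rewrite /zeta3_count /zeta3_summand natr_sum.
rewrite [LHS]big_mkcond [RHS]big_mkcond /=; apply: eq_bigr => e _.
case: leqP => //= bae; rewrite /zeta3_weight.
(* Identifies the bound c <= 2e + f of [zeta3_weight], for f = b - e, with c <= b + e. *)
have -> : (e.*2 + (b - e) = b + e)%N by have := ltn_ord e; rewrite ltnS -addnn => eb; rewrite -addnA subnKC // addnC.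
case: ifP => _; last by rewrite mulr0.
by rewrite natrM natrX unit_countnE.
Qed.

End ZetaSeries.

(** * Counting residues modulo powers of the uniformizer *)

Section Transversal.
Local Open Scope ring_scope.
Variable V : zmodType.
Implicit Types (U : V -> Prop) (s : seq V).

Definition subgroup U := U 0 /\ forall x y, U x -> U y -> U (x - y).

(** Existence and uniqueness of the representative become one numerical equation, convenient for
    double counting and for lists of pairs. *)
Definition transversal U s := forall x, count (fun r => `[< U (x - r) >]) s = 1%N.

Lemma transversalP U s : subgroup U ->
  ((forall i j, (i < size s)%N -> (j < size s)%N -> i <> j -> ~ U (nth 0 s i - nth 0 s j)) /\
   (forall x, exists2 i, (i < size s)%N & U (x - nth 0 s i))) <-> transversal U s.
Proof.
move=> [U0 UB]; split=> [[dist ex] x|tr].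
  have [i i_lt Ui] := ex x.
  rewrite -sum1_count (big_nth 0) big_mkord (big_pred1 (Ordinal i_lt)) // => j.
  rewrite /= -val_eqE /=; apply/asboolP/eqP => [Uj|->//].
  apply/eqP; case: eqP => // /(dist _ _ (ltn_ord j) i_lt) [].
  have -> : nth 0 s j - nth 0 s i = (x - nth 0 s i) - (x - nth 0 s j).
    by rewrite opprB [RHS]addrC addrA subrK.
  exact: UB.
split=> [i j i_lt j_lt ij Uij | x].
  have := tr (nth 0 s i); rewrite -sum1_count (big_nth 0) big_mkord.
  rewrite (bigD1 (Ordinal i_lt)) /=; last by apply/asboolP; rewrite subrr.
  rewrite (bigD1 (Ordinal j_lt)) //=; apply/andP; split; first exact/asboolP.
  by rewrite -val_eqE /= eq_sym; apply/eqP.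
have : has (fun r => `[< U (x - r) >]) s by rewrite has_count tr.
by move=> /(has_nthP 0) [i i_lt /asboolP Ui]; exists i.
Qed.

(** Double counting of the pairs congruent modulo U: each element of either list lies in exactly one
    of them. *)
Lemma transversal_size U s s' : subgroup U ->
  transversal U s -> transversal U s' -> size s = size s'.
Proof.
move=> [U0 UB] tr tr'.
rewrite -!sum1_size.
transitivity (\sum_(x <- s) \sum_(y <- s') `[< U (x - y)%R >])%N.
  by apply: eq_bigr => x _; rewrite -big_mkcond sum1_count tr'.
rewrite exchange_big; apply: eq_bigr => y _ /=.
transitivity (\sum_(x <- s) `[< U (y - x)%R >])%N; last by rewrite -big_mkcond sum1_count tr.
apply: eq_bigr => x _; congr (nat_of_bool _).
by apply/asboolP/asboolP => /(UB _ _ U0); rewrite sub0r opprB.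
Qed.

End Transversal.

Section Valuation.
Local Open Scope ring_scope.
Variables (R : idomainType) (pi : R) (q : nat).
Hypotheses (pi_neq0 : pi != 0) (pi_nunit : pi \isn't a GRing.unit).
Hypothesis unif : forall x : R, x != 0 ->
  exists (u : R) (k : nat), u \is a GRing.unit /\ x = u * pi ^+ k.
Hypothesis res_card : residue_card pi q.

Definition pdvd (k : nat) (x : R) : bool := `[< dvdR (pi ^+ k) x >].

Lemma pdvdP k x : reflect (exists y, x = pi ^+ k * y) (pdvd k x).
Proof. exact: asboolP. Qed.

Lemma pexp_neq0 k : pi ^+ k != 0. Proof. exact: expf_neq0. Qed.

Lemma pdvd0 k : pdvd k 0.
Proof. by apply/pdvdP; exists 0; rewrite mulr0. Qed.

Lemma pdvd_exp0 x : pdvd 0 x.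
Proof. by apply/pdvdP; exists x; rewrite expr0 mul1r. Qed.

Lemma pdvdD k x y : pdvd k x -> pdvd k y -> pdvd k (x + y).
Proof. by move=> /pdvdP[a ->] /pdvdP[b ->]; apply/pdvdP; exists (a + b); rewrite mulrDr. Qed.

Lemma pdvdMr k x y : pdvd k x -> pdvd k (x * y).
Proof. by move=> /pdvdP[a ->]; apply/pdvdP; exists (a * y); rewrite mulrA. Qed.

Lemma pdvdMl k x y : pdvd k x -> pdvd k (y * x).
Proof. by rewrite mulrC; exact: pdvdMr. Qed.

Lemma pdvdN k x : pdvd k (- x) = pdvd k x.
Proof. by apply/idP/idP => /(pdvdMr (-1)); rewrite mulrN1 ?opprK. Qed.

Lemma pdvdB k x y : pdvd k x -> pdvd k y -> pdvd k (x - y).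
Proof. by move=> ? ?; apply: pdvdD; rewrite ?pdvdN. Qed.

Lemma pdvdDr k x y : pdvd k x -> pdvd k (x + y) = pdvd k y.
Proof.
move=> kx; apply/idP/idP => [kxy|]; last exact: pdvdD.
by rewrite -(addKr x y) addrC; apply: pdvdB; rewrite // -[- x + _]addrC.
Qed.

Lemma pdvd_subgroup k : subgroup (dvdR (pi ^+ k)).
Proof.
split; first exact: (elimT (pdvdP _ _) (pdvd0 k)).
by move=> x y /(introT (pdvdP _ _)) kx /(introT (pdvdP _ _)) ky; exact: (elimT (pdvdP _ _) (pdvdB kx ky)).
Qed.

Lemma pdvdW k j x : (j <= k)%N -> pdvd k x -> pdvd j x.
Proof.
by move=> /subnKC <- /pdvdP[a ->]; apply/pdvdP; exists (pi ^+ (k - j) * a); rewrite exprD mulrA.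
Qed.

Lemma pdvd_pexp_mul k j x : pdvd (j + k) (pi ^+ j * x) = pdvd k x.
Proof.
apply/pdvdP/pdvdP => -[y E]; exists y; last by rewrite E exprD mulrA.
by apply: (mulfI (pexp_neq0 j)); rewrite E exprD mulrA.
Qed.

Lemma pdvd1_unit u : u \is a GRing.unit -> pdvd 1 u = false.
Proof.
move=> uu; apply/negP => /pdvdP[y E]; move: uu; rewrite E expr1 unitrM.
by rewrite (negPf pi_nunit).
Qed.

Lemma pdvd_unit_mul k u x : u \is a GRing.unit -> pdvd k (u * x) = pdvd k x.
Proof.
move=> uu; apply/idP/idP => [|/pdvdMl//].
by move=> /(pdvdMl u^-1); rewrite mulKr.
Qed.

Lemma pdvd_pexp k j : pdvd k (pi ^+ j) = (k <= j)%N.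
Proof.
case: leqP => [kj|jk]; first by apply/pdvdP; exists (pi ^+ (j - k)); rewrite -exprD subnKC.
apply/negbTE/negP => /(pdvdW (j:=j.+1) jk); rewrite -addn1 -[X in pdvd _ X]mulr1.
by rewrite pdvd_pexp_mul pdvd1_unit // unitr1.
Qed.

(** With at most one representative, 0 and 1 would be congruent and pi would divide 1. The bound
    makes k recoverable from q^k. *)
Lemma residue_card_gt1 : (1 < q)%N.
Proof.
have [s [<- _ ex]] := res_card; rewrite ltnNge; apply/negP => s1.
have [i il [a Ea]] := ex 0; have [j jl [b Eb]] := ex 1.
have {j jl Eb} Eb : 1 - nth 0 s i = pi * b.
  by rewrite (_ : i = j) //; lia.
have : pdvd 1 1 by apply/pdvdP; exists (b - a); rewrite expr1 mulrBr -Ea -Eb; ring.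
by rewrite pdvd1_unit // unitr1.
Qed.

Definition residue_reps : seq R := projT1 (cid res_card).

Lemma size_residue_reps : size residue_reps = q.
Proof. by rewrite /residue_reps; case: cid => s []. Qed.

Lemma residue_reps_transversal : transversal (dvdR (pi ^+ 1)) residue_reps.
Proof.
apply/(transversalP _ (pdvd_subgroup 1)); rewrite expr1.
by rewrite /residue_reps; case: cid => s /= [<-].
Qed.

(** The pi-adic expansions with k digits taken from [residue_reps]. *)
Fixpoint pexp_reps (k : nat) : seq R :=
  if k is k'.+1 then [seq r0 + pi * r | r0 <- residue_reps, r <- pexp_reps k'] else [:: 0].

Lemma size_pexp_reps k : size (pexp_reps k) = (q ^ k)%N.
Proof. by elim: k => //= k IH; rewrite size_allpairs size_residue_reps IH expnS. Qed.

(** Induction on the digits: for e > 0 the first digit is forced by x modulo pi, and division by pi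
    lowers e and k by one. The case e = k gives a transversal, the case x = 0 counts multiples of
    pi^e. *)
Lemma count_pexp_reps e k x : (e <= k)%N ->
  count (fun r => pdvd e (x - r)) (pexp_reps k) = (q ^ (k - e))%N.
Proof.
elim: k e x => [|k IH] [|e] x // ek.
- by rewrite /= pdvd_exp0.
- rewrite (eq_count (a2 := predT)) ?count_predT ?size_pexp_reps //.
  by move=> r; rewrite pdvd_exp0.
rewrite -sum1_count big_mkcond big_allpairs_dep /=.
transitivity (\sum_(r0 <- residue_reps | pdvd 1 (x - r0)%R) q ^ (k - e))%N; last first.
  by rewrite big_const_seq iter_addn_0 residue_reps_transversal muln1 subSS.
rewrite [RHS]big_mkcond; apply: eq_bigr => r0 _ /=; case: ifP => [/pdvdP[y Ey]|N].
  rewrite -(IH _ y ek) -[RHS]sum1_count [RHS]big_mkcond; apply: eq_bigr => r _ /=.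
  by rewrite opprD addrA Ey -mulrBr -add1n pdvd_pexp_mul.
apply: big1 => r _; case: ifP => // /(pdvdW (ltn0Sn e)).
by rewrite opprD addrA addrC pdvdDr ?N // pdvdN pdvdMr // -[X in pdvd _ X]expr1 pdvd_pexp.
Qed.

Lemma pexp_reps_transversal k : transversal (dvdR (pi ^+ k)) (pexp_reps k).
Proof. by move=> x; rewrite [LHS](count_pexp_reps _ (leqnn k)) subnn. Qed.

Lemma count_pdvd e k : (e <= k)%N -> count (pdvd e) (pexp_reps k) = (q ^ (k - e))%N.
Proof.
move=> ek; rewrite -(count_pexp_reps 0 ek); apply: eq_count => r.
by rewrite sub0r pdvdN.
Qed.

(** If k <= h, the term in y vanishes modulo pi^k. Otherwise pi^h must divide s, and division by
    pi^h determines y modulo pi^(k-h), which leaves q^h residues modulo pi^k. *)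
Lemma count_linear_congr k h u s : u \is a GRing.unit ->
  count (fun y => pdvd k (u * pi ^+ h * y + s)) (pexp_reps k) =
  if pdvd (minn h k) s then (q ^ minn h k)%N else 0%N.
Proof.
move=> uu; case: (leqP k h) => [kh|hk].
  have E y : pdvd k (u * pi ^+ h * y + s) = pdvd k s.
    by rewrite pdvdDr // pdvdMr // pdvdMl // pdvd_pexp.
  rewrite (eq_count E); case: (pdvd k s); last exact: count_pred0.
  by rewrite count_predT size_pexp_reps.
case: ifP => [/pdvdP[s' ->]|N].
  rewrite -[in RHS](subKn (ltnW hk)) -(count_pexp_reps (- (u^-1 * s')) (leq_subr h k)).
  apply: eq_count => y; rewrite mulrAC [X in X + _]mulrC -mulrDr -{1}(subnKC (ltnW hk)).
  rewrite pdvd_pexp_mul -[RHS](pdvd_unit_mul _ _ uu) -[RHS]pdvdN; congr pdvd.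
  by rewrite -mulrN opprD !opprK mulrDr mulVKr // addrC.
rewrite (eq_count (a2 := pred0)) ?count_pred0 // => y /=.
apply/negP => /(pdvdW (ltnW hk)); rewrite pdvdDr ?N // pdvdMr // pdvdMl // pdvd_pexp //.
Qed.

(** This is min(v(x), b), with value b at x = 0; counting the exponents that divide x avoids
    choosing a valuation. *)
Definition truncated_val (b : nat) (x : R) : nat := \sum_(e < b) pdvd e.+1 x.

Lemma truncated_valP b x :
  (exists2 u, u \is a GRing.unit & (truncated_val b x < b)%N /\ x = u * pi ^+ truncated_val b x)
  \/ (truncated_val b x = b /\ pdvd b x).
Proof.
case: (boolP (pdvd b x)) => [bx|Nbx]; [right; split=> //|left].
  rewrite /truncated_val (eq_bigr (fun=> 1%N)) ?sum1_card ?card_ord // => e _.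
  by rewrite (pdvdW _ bx).
have x0 : x != 0 by apply: contraNneq Nbx => ->; exact: pdvd0.
have [u [j [uu Ex]]] := unif x0; exists u => //.
have dv e : pdvd e x = (e <= j)%N by rewrite Ex pdvd_unit_mul // pdvd_pexp.
have jb : (j < b)%N by rewrite ltnNge -dv.
suff -> : truncated_val b x = j by [].
rewrite /truncated_val; under eq_bigr => e _ do rewrite dv.
by rewrite -big_mkcond /= -(big_ord_widen b (fun=> 1%N) (ltnW jb)) sum1_card card_ord.
Qed.

Lemma truncated_val_le b x : (truncated_val b x <= b)%N.
Proof. by case: (truncated_valP b x) => [[u _ [/ltnW]]|[->]]. Qed.

Lemma truncated_val_pdvd b e x : (e <= b)%N -> pdvd e x = (e <= truncated_val b x)%N.
Proof.
move=> eb; case: (truncated_valP b x) => [[u uu [_ E]]|[-> bx]].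
  by rewrite {1}E pdvd_unit_mul // pdvd_pexp.
by rewrite eb (pdvdW eb).
Qed.

(** For e < b, the multiples of pi^(e+1) are removed from those of pi^e; for e = b only the zero
    class remains. *)
Lemma count_truncated_val b e : (e <= b)%N ->
  count (fun x => truncated_val b x == e) (pexp_reps b) = unit_countn q (b - e).
Proof.
rewrite leq_eqVlt => /orP[/eqP->|eb].
  rewrite subnn /= -[RHS](expn0 q) -[in RHS](subnn b) -(count_pdvd (leqnn b)).
  by apply: eq_count => x; rewrite (truncated_val_pdvd _ (leqnn b)) eqn_leq truncated_val_le.
have -> : unit_countn q (b - e) = (q ^ (b - e) - q ^ (b - e.+1))%N.
  by rewrite subnS; case: (b - e)%N (subn_gt0 e b); rewrite ?eb.
rewrite -(count_pdvd (ltnW eb)) -(count_pdvd eb).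
rewrite -(addKn (count (pdvd e.+1) (pexp_reps b)) (count _ _)); congr (_ - _)%N.
rewrite -count_predUI -[RHS]addn0; congr (_ + _)%N.
  apply: eq_count => x /=; rewrite !(truncated_val_pdvd (b := b)) ?(ltnW eb) //.
  by rewrite orbC eq_sym -leq_eqVlt.
rewrite (eq_count (a2 := pred0)) ?count_pred0 // => x /=.
by rewrite (truncated_val_pdvd _ eb); case: eqP => [->|]; rewrite ?ltnn ?andbF.
Qed.

(* The condition for the span of (pi^a, x, y), (0, pi^b, z), (0, 0, pi^c) to be
   closed under multiplication; w is the quotient pi^a x / pi^b. *)
Definition subalg3_cond (a b c : nat) (x z y : R) : Prop :=
  [/\ dvdR (pi ^+ c) (pi ^+ b.*2), dvdR (pi ^+ c) (x * pi ^+ b) &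
      exists2 w, w * pi ^+ b = pi ^+ a * x & dvdR (pi ^+ c) (pi ^+ a * y + (x ^+ 2 - w * z))].

Definition num_subalg3 (a b c : nat) : nat :=
  \sum_(x <- pexp_reps b) \sum_(z <- pexp_reps c)
    count (fun y => `[< subalg3_cond a b c x z y >]) (pexp_reps c).

Lemma sum_pexp_reps_const k n : (\sum_(r <- pexp_reps k) n)%N = (q ^ k * n)%N.
Proof. by rewrite big_const_seq iter_addn_0 count_predT size_pexp_reps mulnC. Qed.

(** The congruence is solved for the variable whose coefficient has the smaller valuation. For e < b
    this is z, with valuation d = a + e - b < a; for e = b it is y, with valuation a. *)
Lemma num_subalg3_fiber a b c x (e := truncated_val b x) :
  (\sum_(z <- pexp_reps c) count (fun y => `[< subalg3_cond a b c x z y >]) (pexp_reps c))%N =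
  if [&& b <= a + e, c <= b + e & minn (a + e - b) c <= e.*2]%N
  then (q ^ (c + minn (a + e - b) c))%N else 0%N.
Proof.
have z0 (F : R -> R -> Prop) : (forall z y, ~ F z y) ->
    (\sum_(z <- pexp_reps c) count (fun y => `[< F z y >]) (pexp_reps c))%N = 0%N.
  move=> N; apply: big1 => z _; rewrite (eq_count (a2 := pred0)) ?count_pred0 // => y.
  by apply/asboolP; exact: N.
case: (truncated_valP b x) => [[u uu [eb Ex]]|[Ee bx]].
  rewrite -/e in eb Ex.
  case: (leqP b (a + e)) => bae; last first.
    apply: z0 => z y [_ _ [w Ew _]]; move: bae; rewrite ltnNge => /negP; apply.
    rewrite -(pdvd_pexp b) -(pdvd_unit_mul _ _ uu) exprD mulrCA -Ex -Ew.
    by apply: pdvdMl; rewrite pdvd_pexp.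
  case: (leqP c (b + e)) => cbe /=; last first.
    apply: z0 => z y [_ /(introT (pdvdP _ _)) cx _]; move: cbe; rewrite ltnNge => /negP; apply.
    by rewrite -(pdvd_pexp c) -(pdvd_unit_mul _ _ uu) addnC exprD mulrA -Ex.
  set d := (a + e - b)%N.
  have da : (d <= a)%N by rewrite /d; lia.
  have Ew w : (w * pi ^+ b = pi ^+ a * x) <-> w = u * pi ^+ d.
    rewrite Ex mulrCA -exprD -(subnK bae) exprD mulrA -/d; split=> [|->//].
    by move/(mulIf (pexp_neq0 b)).
  have C z y : `[< subalg3_cond a b c x z y >] = pdvd c (- u * pi ^+ d * z + (pi ^+ a * y + x ^+ 2)).
    rewrite -[pdvd _ _]asboolb; apply: asbool_equiv_eq.
    rewrite (_ : - u * pi ^+ d * z + _ = pi ^+ a * y + (x ^+ 2 - u * pi ^+ d * z)); last by ring.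
    split=> [[_ _ [w /Ew -> ?]]|/pdvdP ?]; first exact/pdvdP.
    split; last by exists (u * pi ^+ d); first exact/Ew.
      by apply/pdvdP; rewrite pdvd_pexp -addnn (leq_trans cbe) // leq_add2l ltnW.
    by apply/pdvdP; rewrite Ex -mulrA pdvd_unit_mul // -exprD pdvd_pexp addnC.
  under eq_bigr => z _ do (rewrite (eq_count (C z)) -sum1_count big_mkcond /=).
  rewrite exchange_big /=.
  under eq_bigr => y _ do rewrite -big_mkcond sum1_count count_linear_congr ?unitrN //=.
  (* As d <= a, solvability in z does not depend on y: it means that pi^min(d, c) divides x^2, that
     is min(d, c) <= 2e. *)
  transitivity (\sum_(y <- pexp_reps c) if (minn d c <= e.*2)%N then q ^ minn d c else 0)%N.
    apply: eq_bigr => y _; congr (if _ then _ else _).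
    rewrite pdvdDr; last by rewrite pdvdMr // pdvd_pexp geq_min da.
    by rewrite Ex exprMn pdvd_unit_mul ?unitrX // -exprM pdvd_pexp muln2.
  by rewrite sum_pexp_reps_const; case: ifP; rewrite ?muln0 // expnD.
rewrite /e Ee leq_addl addnK addnn.
case: (leqP c b.*2) => cb /=; last first.
  apply: z0 => z y [/(introT (pdvdP _ _)) cb' _ _]; move: cb'; rewrite pdvd_pexp.
  by rewrite leqNgt cb.
(* For e = b the exponent d is a, and min(a, c) <= 2b follows from c <= 2b. *)
rewrite geq_min cb orbT.
have [x' Ex] := elimT (pdvdP _ _) bx.
have Ew w : (w * pi ^+ b = pi ^+ a * x) <-> w = pi ^+ a * x'.
  rewrite Ex mulrCA mulrC; split=> [|->//].
  by move/(mulfI (pexp_neq0 b)).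
have C z y : `[< subalg3_cond a b c x z y >] = pdvd c (1 * pi ^+ a * y + (x ^+ 2 - pi ^+ a * x' * z)).
  rewrite -[pdvd _ _]asboolb; apply: asbool_equiv_eq; rewrite mul1r.
  split=> [[_ _ [w /Ew -> ?]]|/pdvdP ?]; first exact/pdvdP.
  split; last by exists (pi ^+ a * x'); first exact/Ew.
    by apply/pdvdP; rewrite pdvd_pexp.
  by apply/pdvdP; rewrite Ex mulrAC -exprD pdvdMr // pdvd_pexp addnn.
under eq_bigr => z _ do rewrite (eq_count (C z)) count_linear_congr ?unitr1 //=.
rewrite expnD -sum_pexp_reps_const; apply: eq_bigr => z _; rewrite ifT //.
apply: pdvdB; last by rewrite !pdvdMr // pdvd_pexp geq_minl.
rewrite Ex exprMn -exprM pdvdMr // pdvd_pexp muln2.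
by rewrite (leq_trans _ cb) ?geq_minr.
Qed.

Lemma num_subalg3E a b c : num_subalg3 a b c = zeta3_count q a b c.
Proof.
rewrite /num_subalg3 (partition_big (fun x => inord (truncated_val b x) : 'I_b.+1) predT) //=.
rewrite /zeta3_count [RHS]big_mkcond; apply: eq_bigr => e _ /=.
have eb : (e <= b)%N by rewrite -ltnS.
have E x : (inord (truncated_val b x) == e :> 'I_b.+1) = (truncated_val b x == e).
  by rewrite -val_eqE /= inordK // ltnS truncated_val_le.
under eq_bigl => x do rewrite E.
under eq_bigr => x /eqP Ex do rewrite num_subalg3_fiber Ex.
rewrite big_const_seq iter_addn_0 count_truncated_val // mulnC.
by case: ifP; rewrite ?muln0.
Qed.

Lemma num_subalg2E a b :
  count (fun x => `[< dvdR (pi ^+ b) (pi ^+ a * x) >]) (pexp_reps b) = (q ^ minn a b)%N.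
Proof.
have := count_linear_congr b a 0 (unitr1 R); rewrite pdvd0 => <-.
by apply: eq_count => x; rewrite mul1r addr0.
Qed.

End Valuation.

(** * Finite-index submodules in triangular form *)

Section TransversalMore.
Local Open Scope ring_scope.
Variables (V : zmodType) (U : V -> Prop) (s : seq V).
Hypotheses (Usub : subgroup U) (Utr : transversal U s).

Lemma transversal_inj : {in s &, forall x y, U (x - y) -> x = y}.
Proof.
move=> x y xs ys Uxy; have [_ /(_ Utr) [dist _]] := transversalP s Usub.
apply: contrapT => xy; apply: (dist (index x s) (index y s)); rewrite ?index_mem ?nth_index //.
by move=> E; apply: xy; rewrite -(nth_index 0 xs) E nth_index.
Qed.

Lemma transversal_uniq : uniq s.
Proof.
apply/(uniqP 0) => i j ilt jlt E; have [_ /(_ Utr) [dist _]] := transversalP s Usub.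
by apply: contrapT => /(dist i j ilt jlt) []; rewrite E subrr; case: Usub.
Qed.

Lemma transversal_rep x : exists2 y, y \in s & U (x - y).
Proof.
have : has (fun r => `[< U (x - r) >]) s by rewrite has_count Utr.
by case/hasP => y ys /asboolP; exists y.
Qed.

End TransversalMore.

Section Submodules.
Local Open Scope ring_scope.
Variables (R : idomainType) (pi : R) (q : nat).
Hypotheses (pi_neq0 : pi != 0) (pi_nunit : pi \isn't a GRing.unit).
Hypothesis unif : forall x : R, x != 0 ->
  exists (u : R) (k : nat), u \is a GRing.unit /\ x = u * pi ^+ k.
Hypothesis res_card : residue_card pi q.

Let reps := pexp_reps res_card.

Definition submod n (U : 'rV[R]_n -> Prop) : Prop :=
  [/\ U 0, forall x y, U x -> U y -> U (x + y) & forall (c : R) x, U x -> U (c *: x)].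

Lemma submod_subgroup n (U : 'rV[R]_n -> Prop) : submod U -> subgroup U.
Proof.
move=> [U0 UD UZ]; split=> // x y Ux Uy; apply: UD => //.
by rewrite -scaleN1r; exact: UZ.
Qed.

Lemma has_indexP n (U : 'rV[R]_n -> Prop) m : submod U ->
  has_index U m <-> exists2 s, size s = m & transversal U s.
Proof.
move=> /submod_subgroup Us; split=> [[s [<- dist ex]]|[s <- /(transversalP s Us) [dist ex]]].
  by exists s => //; apply/(transversalP s Us).
by exists s.
Qed.

Lemma has_index_uniq n (U : 'rV[R]_n -> Prop) m s : submod U ->
  has_index U m -> transversal U s -> m = size s.
Proof.
move=> Um /(has_indexP _ Um) [s' <- tr'] tr.
exact: transversal_size (submod_subgroup Um) tr' tr.
Qed.

(** The form in which finite index is used for the reduction to triangular form: it passes at once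
    to the module of tails in [submod_ext]. *)
Definition contains_pexp n (U : 'rV[R]_n -> Prop) : Prop := exists N, forall x, U (pi ^+ N *: x).

Lemma unit_1subpexp j : 1 - pi ^+ j.+1 \is a GRing.unit.
Proof.
have N1 : ~~ pdvd pi 1 1 by rewrite pdvd1_unit // unitr1.
have pj : pdvd pi 1 (pi ^+ j.+1) by rewrite pdvd_pexp.
have [E|/unif [u [[|k] [uu E]]]] := eqVneq (1 - pi ^+ j.+1) 0.
- by move/eqP: E N1; rewrite subr_eq0 => /eqP ->; rewrite pj.
- by rewrite E expr0 mulr1.
move: N1; rewrite -(subrK (pi ^+ j.+1) 1) E addrC pdvdDr // pdvd_unit_mul //.
by rewrite pdvd_pexp.
Qed.

(** Pigeonhole: among pi^0 x, ..., pi^m x two are congruent modulo U. Their difference is pi^j x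
    times the unit 1 - pi^(l-j) with j < l <= m, so pi^m x lies in U, with an exponent independent
    of x. *)
Lemma has_index_contains_pexp n (U : 'rV[R]_n -> Prop) m : submod U ->
  has_index U m -> contains_pexp U.
Proof.
move=> Um [s [sz _ ex]]; have [U0 UD UZ] := Um; have [_ UB] := submod_subgroup Um.
exists m => x.
have ex' (j : 'I_m.+1) : exists i : 'I_m, U (pi ^+ j *: x - nth 0 s i).
  by have [i il Ui] := ex (pi ^+ j *: x); exists (Ordinal il).
have [f fP] := choice ex'.
have : ~~ injectiveb f.
  by apply/injectiveP => /leq_card; rewrite !card_ord ltnn.
case/injectivePn => j [l jl E].
have H (j' l' : 'I_m.+1) : (j' < l')%N -> f j' = f l' -> U (pi ^+ m *: x).
  move=> jl' E'; have := UB _ _ (fP j') (fP l').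
  rewrite E' opprB addrA subrK -scalerBl -(subnKC (ltnW jl')) exprD.
  have := unit_1subpexp (l' - j').-1; rewrite prednK ?subn_gt0 // => uu.
  rewrite -[X in X - _]mulr1 -mulrBr => /(UZ (pi ^+ (m - j') * (1 - pi ^+ (l' - j'))^-1)).
  rewrite scalerA mulrACA mulVr // mulr1 -exprD subnK //.
  by rewrite -ltnS (leq_trans jl') // ltnW // ltn_ord.
have := jl; rewrite neq_ltn => /orP [|] h; first exact: H E.
exact: H (esym E).
Qed.

(* The first coordinates of the vectors of a submodule of R^(1+n) form the
   ideal (pi^a); v is the tail of a vector with first coordinate pi^a, and W
   collects the tails of the vectors with first coordinate 0. *)
Definition ext n (a : nat) (v : 'rV[R]_n) (W : 'rV[R]_n -> Prop) : 'rV[R]_(1 + n) -> Prop :=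
  fun p => exists2 r, p 0 0 = r * pi ^+ a & W (rsubmx p - r *: v).

Definition consv n (x : R) (v : 'rV[R]_n) : 'rV[R]_(1 + n) := row_mx x%:M v.

Lemma consv0 n x (v : 'rV[R]_n) : consv x v 0 0 = x.
Proof.
by rewrite mxE; case: splitP => [j _|k //]; rewrite mxE !ord1 eqxx.
Qed.

Lemma rsubmx_consv n x (v : 'rV[R]_n) : rsubmx (consv x v) = v.
Proof. exact: row_mxKr. Qed.

Lemma consvE n (p : 'rV[R]_(1 + n)) : p = consv (p 0 0) (rsubmx p).
Proof.
rewrite -{1}[p]hsubmxK /consv; congr row_mx; apply/matrixP => i j.
by rewrite !ord1 !mxE eqxx mulr1n; congr (p _ _); exact: val_inj.
Qed.

Lemma consvD n (x x' : R) (w w' : 'rV[R]_n) : consv x w + consv x' w' = consv (x + x') (w + w').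
Proof.
rewrite [LHS]consvE linearD /= !rsubmx_consv; congr consv.
rewrite -[in RHS](consv0 x w) -[in RHS](consv0 x' w').
by move: (consv x w) (consv x' w') => v v'; rewrite mxE.
Qed.

Lemma consvZ n c x (w : 'rV[R]_n) : c *: consv x w = consv (c * x) (c *: w).
Proof.
rewrite [LHS]consvE linearZ /= !rsubmx_consv; congr consv.
by rewrite -[in RHS](consv0 x w); move: (consv x w) => v; rewrite mxE.
Qed.

Lemma consvS n x (v : 'rV[R]_n) i : consv x v 0 (lift 0 i) = v 0 i.
Proof. by rewrite mxE; case: splitP => [[[]]//|k [/val_inj ->]]. Qed.

Lemma ext_consv n a v W x w : @ext n a v W (consv x w) <-> exists2 r, x = r * pi ^+ a & W (w - r *: v).
Proof. by rewrite /ext consv0 rsubmx_consv. Qed.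

Lemma ext_submod n a v W : submod W -> submod (@ext n a v W).
Proof.
move=> [W0 WD WZ]; split.
- by exists 0; rewrite ?mxE ?mul0r // linear0 scale0r subr0.
- move=> x y [r Er Wr] [r' Er' Wr']; exists (r + r'); first by rewrite mxE Er Er' mulrDl.
  by rewrite linearD scalerDl opprD addrACA; exact: WD.
- move=> c x [r Er Wr]; exists (c * r); first by rewrite mxE Er mulrA.
  by rewrite linearZ -scalerA -scalerBr; exact: WZ.
Qed.

Definition ext_reps n a (t : seq 'rV[R]_n) : seq 'rV[R]_(1 + n) :=
  [seq consv x w | x <- reps a, w <- t].

Lemma size_ext_reps n a (t : seq 'rV[R]_n) : size (ext_reps a t) = (q ^ a * size t)%N.
Proof. by rewrite size_allpairs size_pexp_reps. Qed.

(** The first coordinate of p singles out x modulo pi^a and thereby fixes r; then w must represent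
    the tail of p minus r v modulo W. *)
Lemma ext_transversal n a v W t : transversal W t -> transversal (@ext n a v W) (ext_reps a t).
Proof.
move=> tr p; rewrite -sum1_count big_mkcond big_allpairs_dep /=.
rewrite -[RHS](pexp_reps_transversal pi_neq0 pi_nunit res_card a (p 0 0)).
rewrite -sum1_count [RHS]big_mkcond; apply: eq_bigr => x _.
have E w : p - consv x w = consv (p 0 0 - x) (rsubmx p - w).
  rewrite [LHS]consvE linearB /= rsubmx_consv; congr consv.
  by rewrite -[in RHS](consv0 x w); move: (consv x w) => v'; rewrite !mxE.
case: asboolP => [[r Er]|N].
  rewrite -[RHS](tr (rsubmx p - r *: v)) -sum1_count [RHS]big_mkcond; apply: eq_bigr => w _.
  congr (if _ then _ else _); apply: asbool_equiv_eq; rewrite E ext_consv addrAC.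
  split=> [[r' Er']|]; last by exists r; rewrite // Er mulrC.
  by move: Er'; rewrite Er mulrC => /(mulIf (pexp_neq0 pi_neq0 a)) <-.
apply: big1 => w _; case: asboolP => //; rewrite E ext_consv => -[r Er _].
by case: N; exists r; rewrite Er mulrC.
Qed.

Lemma ext_shift n a v v' W : submod W -> W (v - v') -> @ext n a v W = ext a v' W.
Proof.
move=> [W0 WD WZ] Wv; apply/funext => p; apply/propext; split=> -[r Er Wr]; exists r => //.
  rewrite (_ : _ - _ = (rsubmx p - r *: v) + r *: (v - v')).
    by apply: WD => //; exact: WZ.
  by rewrite scalerBr addrA subrK.
rewrite (_ : _ - _ = (rsubmx p - r *: v') + (- r) *: (v - v')).
  by apply: WD => //; exact: WZ.
by rewrite scalerBr !scaleNr opprK [X in _ = _ + X]addrC addrA subrK.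
Qed.

(** The vector (pi^a, v) bounds the other exponent by a, and by symmetry the exponents agree; the
    vectors with first coordinate 0 recover W, and (pi^a, v) then recovers v modulo W. *)
Lemma ext_inj n a v W a' v' W' : submod W -> submod W' ->
  @ext n a v W = ext a' v' W' -> [/\ a = a', W = W' & W (v - v')].
Proof.
move=> Wm Wm' E.
have le b w X b' w' X' : submod X -> @ext n b w X = ext b' w' X' -> (b' <= b)%N.
  move=> [X0 _ _] EX; have : ext b w X (consv (pi ^+ b) w).
    by apply/ext_consv; exists 1; rewrite ?mul1r // scale1r subrr.
  rewrite EX ext_consv => -[r Er _]; rewrite -(pdvd_pexp pi_neq0 pi_nunit).
  by apply/pdvdP; exists r; rewrite mulrC.
have aa : a = a' by apply/eqP; rewrite eqn_leq (le _ _ _ _ _ _ Wm' (esym E)) (le _ _ _ _ _ _ Wm E).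
have tail b w X y : @ext n b w X (consv 0 y) <-> X y.
  rewrite ext_consv; split=> [[r /esym/eqP]|Xy]; last by exists 0; rewrite ?mul0r // scale0r subr0.
  by rewrite mulf_eq0 (negPf (pexp_neq0 pi_neq0 b)) orbF => /eqP ->; rewrite scale0r subr0.
have WW : W = W' by apply/funext => w; apply/propext; rewrite -(tail a v) -(tail a' v') E.
split=> //; have : ext a v W (consv (pi ^+ a) v).
  by apply/ext_consv; exists 1; rewrite ?mul1r // scale1r subrr; case: Wm.
rewrite E ext_consv -aa -WW => -[r /esym]; rewrite -[RHS]mul1r => /(mulIf (pexp_neq0 pi_neq0 a)) ->.
by rewrite scale1r.
Qed.

(** The exponent a is the least one with pi^a a first coordinate. The transversal is quantified
    after W, because representatives modulo W become available only once W is itself in triangular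
    form. *)
Lemma submod_ext n (U : 'rV[R]_(1 + n) -> Prop) : submod U -> contains_pexp U ->
  exists a W, [/\ submod W, contains_pexp W &
    forall s, transversal W s -> exists2 v, v \in s & U = ext a v W].
Proof.
move=> Um [N UN]; have [U0 UD UZ] := Um.
have exk : exists k, `[< exists p, U p /\ p 0 0 = pi ^+ k >].
  exists N; apply/asboolP; exists (pi ^+ N *: consv 1 0); split; first exact: UN.
  by rewrite mxE consv0 mulr1.
case: (ex_minnP exk) => a /asboolP [p [Up pa]] amin.
pose W w := U (consv 0 w); exists a, W.
have Wm : submod W.
  split; rewrite /W.
  - by rewrite (_ : consv 0 0 = 0) // [RHS]consvE mxE linear0.
  - by move=> x y Ux Uy; rewrite -[0]addr0 -consvD; exact: UD.
  - by move=> c x Ux; rewrite -(mulr0 c) -consvZ; exact: UZ.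
split=> //; first by exists N => x; rewrite /W -(mulr0 (pi ^+ N)) -consvZ.
move=> s /transversal_rep /(_ (rsubmx p)) [v vs Wv]; exists v => //.
rewrite -(ext_shift a Wm Wv); apply/funext => y; apply/propext.
have [_ UB] := submod_subgroup Um.
have Ey r : y 0 0 = r * pi ^+ a -> y - r *: p = consv 0 (rsubmx y - r *: rsubmx p).
  move=> Er; rewrite [LHS]consvE; congr consv; last by rewrite linearB linearZ.
  by rewrite !mxE Er pa subrr.
split=> [Uy|[r Er]]; last first.
  by rewrite /W -Ey // => /UD /(_ (UZ r _ Up)); rewrite subrK.
(* If the first coordinate of y is u pi^k, then u^-1 y has first coordinate pi^k, so a <= k by
   minimality. *)
have [r Er] : exists r, y 0 0 = r * pi ^+ a.
  have [->|/unif [u [k [uu Ek]]]] := eqVneq (y 0 0) 0; first by exists 0; rewrite mul0r.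
  have ak : (a <= k)%N.
    apply: amin; apply/asboolP; exists (u^-1 *: y); split; first exact: UZ.
    by rewrite mxE Ek mulKr.
  by exists (u * pi ^+ (k - a)); rewrite -mulrA -exprD subnK.
by exists r => //; rewrite /W -Ey //; apply: UB => //; exact: UZ.
Qed.

Definition full0 : 'rV[R]_0 -> Prop := fun=> True.

Lemma full0_submod : submod full0. Proof. by []. Qed.

Lemma full0_transversal : transversal full0 [:: 0].
Proof. by move=> x /=; rewrite /full0 asboolT. Qed.

Lemma submod0 (U : 'rV[R]_0 -> Prop) : submod U -> U = full0.
Proof. by move=> [U0 _ _]; apply/funext => x; apply/propext; split=> // _; rewrite thinmx0. Qed.

(** Hermite normal forms of rank 1, 2 and 3, obtained by iterating [ext] from the rank 0 module. *)
Definition lattice1 (c : nat) : 'rV[R]_1 -> Prop := @ext 0 c 0 full0.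
Definition lattice2 (b c : nat) (z : R) : 'rV[R]_2 -> Prop := @ext 1 b (consv z 0) (lattice1 c).
Definition lattice3 (a b c : nat) (x z y : R) : 'rV[R]_3 -> Prop :=
  @ext 2 a (consv x (consv y 0)) (lattice2 b c z).

Lemma lattice1_submod c : submod (lattice1 c).
Proof. exact: (@ext_submod 0 c 0 _ full0_submod). Qed.

Lemma lattice2_submod b c z : submod (lattice2 b c z).
Proof. exact: (@ext_submod 1 _ _ _ (lattice1_submod c)). Qed.

Lemma lattice3_submod a b c x z y : submod (lattice3 a b c x z y).
Proof. exact: (@ext_submod 2 _ _ _ (lattice2_submod b c z)). Qed.

Definition reps1 c : seq 'rV[R]_1 := @ext_reps 0 c [:: 0].
Definition reps2 b c : seq 'rV[R]_2 := @ext_reps 1 b (reps1 c).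
Definition reps3 a b c : seq 'rV[R]_3 := @ext_reps 2 a (reps2 b c).

Lemma lattice1_transversal c : transversal (lattice1 c) (reps1 c).
Proof. exact: (@ext_transversal 0 _ _ _ _ full0_transversal). Qed.

Lemma lattice2_transversal b c z : transversal (lattice2 b c z) (reps2 b c).
Proof. exact: (@ext_transversal 1 _ _ _ _ (lattice1_transversal c)). Qed.

Lemma lattice3_transversal a b c x z y : transversal (lattice3 a b c x z y) (reps3 a b c).
Proof. exact: (@ext_transversal 2 _ _ _ _ (lattice2_transversal b c z)). Qed.

Lemma lattice2_index b c z : has_index (lattice2 b c z) (q ^ (b + c)).
Proof.
apply/(has_indexP _ (lattice2_submod b c z)); exists (reps2 b c); last exact: lattice2_transversal.
by rewrite size_ext_reps size_ext_reps muln1 expnD.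
Qed.

Lemma lattice3_index a b c x z y : has_index (lattice3 a b c x z y) (q ^ (a + b + c)).
Proof.
apply/(has_indexP _ (lattice3_submod a b c x z y)); exists (reps3 a b c); last exact: lattice3_transversal.
by rewrite size_ext_reps size_ext_reps size_ext_reps muln1 -addnA !expnD.
Qed.

Lemma submod1_lattice (U : 'rV[R]_1 -> Prop) : submod U -> contains_pexp U ->
  exists c, U = lattice1 c.
Proof.
move=> Um Uc; have [c [W [/submod0 -> _ Wv]]] := @submod_ext 0 U Um Uc.
by have [v _ ->] := Wv _ full0_transversal; exists c; rewrite /lattice1 [v]thinmx0.
Qed.

Lemma submod2_lattice (U : 'rV[R]_2 -> Prop) : submod U -> contains_pexp U ->
  exists b c z, z \in reps c /\ U = lattice2 b c z.
Proof.
move=> Um Uc; have [b [W [Wm Wc Wv]]] := @submod_ext 1 U Um Uc.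
have [c Ec] := submod1_lattice Wm Wc; rewrite Ec in Wv.
have [v /allpairsP [[z w] [/= zc]]] := Wv _ (lattice1_transversal c).
by rewrite inE => /eqP -> -> ->; exists b, c, z.
Qed.

Lemma submod3_lattice (U : 'rV[R]_3 -> Prop) : submod U -> contains_pexp U ->
  exists a b c x z y, [/\ x \in reps b, z \in reps c, y \in reps c & U = lattice3 a b c x z y].
Proof.
move=> Um Uc; have [a [W [Wm Wc Wv]]] := @submod_ext 2 U Um Uc.
have [b [c [z [zc Ez]]]] := submod2_lattice Wm Wc; rewrite Ez in Wv.
have [v /allpairsP [[x w] [/= xb /allpairsP [[y w'] [/= yc]]]]] := Wv _ (lattice2_transversal b c z).
by rewrite inE => /eqP -> -> -> ->; exists a, b, c, x, z, y.
Qed.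

End Submodules.

(** * Multiplicatively closed lattices *)

Section Subalgebras.
Local Open Scope ring_scope.
Variables (R : idomainType) (pi : R) (q : nat).
Hypotheses (pi_neq0 : pi != 0) (pi_nunit : pi \isn't a GRing.unit).
Hypothesis unif : forall x : R, x != 0 ->
  exists (u : R) (k : nat), u \is a GRing.unit /\ x = u * pi ^+ k.
Hypothesis res_card : residue_card pi q.

Let reps := pexp_reps res_card.

Lemma lattice1_inj c c' : lattice1 pi c = lattice1 pi c' -> c = c'.
Proof.
by case/(ext_inj (n := 0) pi_neq0 pi_nunit (@full0_submod R) (@full0_submod R)).
Qed.

(** [ext_inj] identifies z and z' only modulo pi^c; being chosen representatives, they are then
    equal. *)
Lemma lattice2_inj b c z b' c' z' : z \in reps c -> z' \in reps c' ->
  lattice2 pi b c z = lattice2 pi b' c' z' -> [/\ b = b', c = c' & z = z'].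
Proof.
move=> zc zc' /(ext_inj (n := 1) pi_neq0 pi_nunit (lattice1_submod pi c) (lattice1_submod pi c')).
case=> -> /lattice1_inj E; move: zc'; rewrite -E => zc' dz; split=> //.
have := transversal_inj (submod_subgroup (lattice1_submod pi c))
  (lattice1_transversal pi_neq0 pi_nunit res_card c).
have v0 : 0 \in [:: 0 : 'rV[R]_0] by rewrite inE.
move/(_ _ _ (allpairs_f (@consv R 0) zc v0) (allpairs_f (@consv R 0) zc' v0) dz).
by move/(congr1 (fun v : 'rV_1 => v 0 0)); rewrite !consv0.
Qed.

Lemma lattice3_inj a b c x z y a' b' c' x' z' y' :
  x \in reps b -> z \in reps c -> y \in reps c ->
  x' \in reps b' -> z' \in reps c' -> y' \in reps c' ->
  lattice3 pi a b c x z y = lattice3 pi a' b' c' x' z' y' ->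
  [/\ a = a', b = b' & c = c'] /\ [/\ x = x', z = z' & y = y'].
Proof.
move=> xb zc yc xb' zc' yc'.
case/(ext_inj (n := 2) pi_neq0 pi_nunit (lattice2_submod pi b c z) (lattice2_submod pi b' c' z')).
move=> -> /(lattice2_inj zc zc') [Eb Ec Ez]; move: xb' yc'; rewrite -Eb -Ec => xb' yc' dv.
have := transversal_inj (submod_subgroup (lattice2_submod pi b c z))
  (lattice2_transversal pi_neq0 pi_nunit res_card b c z).
have v0 : 0 \in [:: 0 : 'rV[R]_0] by rewrite inE.
have w0 := allpairs_f (@consv R 0) yc v0; have w0' := allpairs_f (@consv R 0) yc' v0.
move/(_ _ _ (allpairs_f (@consv R 1) xb w0) (allpairs_f (@consv R 1) xb' w0') dv) => E.
have /= := congr1 (fun v : 'rV_2 => v 0 0) E; rewrite !consv0 => Ex.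
by have /= := congr1 (fun v : 'rV_2 => v 0 (lift 0 0)) E; rewrite !consvS !consv0 => Ey.
Qed.

Definition vec2 (x y : R) : 'rV[R]_2 := @consv R 1 x (consv y 0).
Definition vec3 (x y z : R) : 'rV[R]_3 := @consv R 2 x (vec2 y z).

Lemma vec2P (p : 'rV[R]_2) : exists x y, p = vec2 x y.
Proof.
rewrite (consvE (n := 1) p); move: (p 0 0) (rsubmx _) => x v; exists x.
exists (v 0 0); congr consv; rewrite [LHS](consvE (n := 0)); congr consv; exact: thinmx0.
Qed.

Lemma vec3P (p : 'rV[R]_3) : exists x y z, p = vec3 x y z.
Proof.
rewrite (consvE (n := 2) p); move: (p 0 0) (rsubmx _) => x v; exists x.
by have [y [z ->]] := vec2P v; exists y, z.
Qed.

Lemma tmul_vec2 x y x' y' :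
  tmul (vec2 x y) (vec2 x' y') = vec2 (x * x') (x * y' + y * x').
Proof.
apply/rowP => k; rewrite [LHS]mxE; under eq_bigr => i _ do rewrite big_mkcond.
rewrite !big_ord_recl !big_ord0.
case: (unliftP ord0 k) => [k' ->|->]; [rewrite (ord1 k')|];
by rewrite /= ?add0r ?addr0 /vec2 !(consvS, consv0).
Qed.

Lemma tmul_vec3 x y z x' y' z' :
  tmul (vec3 x y z) (vec3 x' y' z') =
  vec3 (x * x') (x * y' + y * x') (x * z' + y * y' + z * x').
Proof.
apply/rowP => k; rewrite [LHS]mxE; under eq_bigr => i _ do rewrite big_mkcond.
rewrite !big_ord_recl !big_ord0.
case: (unliftP ord0 k) => [k' ->|->]; [case: (unliftP ord0 k') => [k'' ->|->]; [rewrite (ord1 k'')|]|];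
by rewrite /= ?add0r ?addr0 /vec3 /vec2 !(consvS, consv0) ?addrA.
Qed.

Lemma lattice2_vec b c z p0 p1 : lattice2 pi b c z (vec2 p0 p1) <->
  exists s t, p0 = s * pi ^+ b /\ p1 = s * z + t * pi ^+ c.
Proof.
rewrite /lattice2 /vec2 ext_consv; split=> [[s Es]|[s [t [Es Et]]]].
  rewrite -scaleNr consvZ consvD => /ext_consv [t Et _]; exists s, t; split=> //.
  by rewrite -Et mulNr addrC subrK.
exists s => //; rewrite -scaleNr consvZ consvD; apply/ext_consv; exists t => //.
by rewrite Et mulNr addrC addrA addNr add0r.
Qed.

Lemma lattice3_vec a b c x z y p0 p1 p2 : lattice3 pi a b c x z y (vec3 p0 p1 p2) <->
  exists r s t, [/\ p0 = r * pi ^+ a, p1 = r * x + s * pi ^+ b &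
                    p2 = r * y + s * z + t * pi ^+ c].
Proof.
rewrite /lattice3 /vec3 ext_consv; split=> [[r Er]|[r [s [t [Er Es Et]]]]].
  rewrite -scaleNr /vec2 consvZ consvD consvZ consvD scaler0 addr0.
  move=> /lattice2_vec [s [t [Es Et]]]; exists r, s, t; split=> //.
    by rewrite -Es mulNr addrC subrK.
  by rewrite -addrA -Et mulNr addrC subrK.
exists r => //; rewrite -scaleNr /vec2 consvZ consvD consvZ consvD scaler0 addr0.
apply/lattice2_vec; exists s, t; rewrite Es Et; split; ring.
Qed.

(** The square of (pi^b, z) is pi^b (pi^b, z) + (0, pi^b z), so closure amounts to (0, pi^b z) being
    in the lattice; the other products of generators give no condition. *)
Lemma lattice2_subalg b c z : is_subalg (lattice2 pi b c z) <-> dvdR (pi ^+ c) (pi ^+ b * z).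
Proof.
have [L0 LD LZ] := lattice2_submod pi b c z.
have pc := pexp_neq0 pi_neq0.
split=> [[_ _ _ LM]|[k Ek]].
  have v1 : lattice2 pi b c z (vec2 (pi ^+ b) z).
    by apply/lattice2_vec; exists 1, 0; split; ring.
  have := LM _ _ v1 v1; rewrite tmul_vec2 => /lattice2_vec [s [t [/(mulIf (pc b)) <- Et]]].
  exists t; apply/eqP; rewrite -subr_eq0; apply/eqP.
  transitivity (pi ^+ b * z + z * pi ^+ b - (pi ^+ b * z + t * pi ^+ c)); first by ring.
  by rewrite Et subrr.
split=> // u v; have [p0 [p1 ->]] := vec2P u; have [p0' [p1' ->]] := vec2P v.
move=> /lattice2_vec [s [t [-> ->]]] /lattice2_vec [s' [t' [-> ->]]].
rewrite tmul_vec2; apply/lattice2_vec.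
exists (s * s' * pi ^+ b), (s * s' * k + (s * t' + s' * t) * pi ^+ b); split; first by ring.
transitivity (s * s' * (pi ^+ b * z) + s * s' * pi ^+ b * z + (s * t' + s' * t) * pi ^+ b * pi ^+ c).
  by ring.
by rewrite {1}Ek; ring.
Qed.

(** Let g1, g2, g3 be the rows. Then g2^2 = (0, 0, pi^2b), g1 g2 = pi^a g2 + (0, 0, x pi^b) and g1^2
    = pi^a g1 + (0, pi^a x, pi^a y + x^2). These yield the three conditions, the last after
    subtracting w g2; products with g3 lie in the lattice anyway. *)
Lemma lattice3_subalg a b c x z y :
  is_subalg (lattice3 pi a b c x z y) <-> subalg3_cond pi a b c x z y.
Proof.
have [L0 LD LZ] := lattice3_submod pi a b c x z y.
have pc := pexp_neq0 pi_neq0.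
split=> [[_ _ _ LM]|[[k1 E1] [k2 E2] [w Ew [k3 E3]]]].
  have v1 : lattice3 pi a b c x z y (vec3 (pi ^+ a) x y).
    by apply/lattice3_vec; exists 1, 0, 0; split; ring.
  have v2 : lattice3 pi a b c x z y (vec3 0 (pi ^+ b) z).
    by apply/lattice3_vec; exists 0, 1, 0; split; ring.
  have zero_r k r : 0 = r * pi ^+ k -> r = 0.
    by move/esym/eqP; rewrite mulf_eq0 (negPf (pc k)) orbF => /eqP.
  split.
  - have := LM _ _ v2 v2; rewrite tmul_vec3 => /lattice3_vec [r [s [t [E0 E1 E2]]]].
    move: E0; rewrite mul0r => /zero_r r0; move: E1; rewrite r0 !(mul0r, mulr0) !add0r => /zero_r s0.
    exists t; rewrite mulrC -[RHS]add0r -[RHS]add0r.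
    by rewrite -addnn exprD; move: E2; rewrite r0 s0 !(mul0r, mulr0) !(add0r, addr0).
  - have := LM _ _ v1 v2; rewrite tmul_vec3 => /lattice3_vec [r [s [t [E0 E1 E2]]]].
    move: E0; rewrite mulr0 => /zero_r r0; move: E1.
    rewrite r0 mul0r mulr0 addr0 add0r => /(mulIf (pc b)) E1.
    exists t; move: E2; rewrite r0 -E1 mul0r mulr0 addr0 add0r => /addrI ->; exact: mulrC.
  have := LM _ _ v1 v1; rewrite tmul_vec3 => /lattice3_vec [r [s [t [E0 E1 E2]]]].
  move/(mulIf (pc a)): E0 => E0; exists s.
    apply/eqP; rewrite -subr_eq0; apply/eqP; rewrite -E0 in E1.
    transitivity (pi ^+ a * x + s * pi ^+ b - (pi ^+ a * x + x * pi ^+ a)); first by ring.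
    by rewrite -E1 subrr.
  exists t; apply/eqP; rewrite -subr_eq0; apply/eqP; rewrite -E0 in E2.
  transitivity (pi ^+ a * y + x * x + y * pi ^+ a - (pi ^+ a * y + s * z + t * pi ^+ c)).
    by ring.
  by rewrite E2 subrr.
split=> // u v; have [p0 [p1 [p2 ->]]] := vec3P u; have [p0' [p1' [p2' ->]]] := vec3P v.
move=> /lattice3_vec [r [s [t [-> -> ->]]]] /lattice3_vec [r' [s' [t' [-> -> ->]]]].
rewrite tmul_vec3; apply/lattice3_vec.
(* Coordinates of the product in g1, g2, g3, by bilinear expansion; k1, k2, k3 come from g2^2, g1
   g2, g1^2, and g1 g3 = pi^a g3. *)
exists (r * r' * pi ^+ a), (r * r' * w + (r * s' + r' * s) * pi ^+ a),
  (r * r' * k3 + (r * s' + r' * s) * k2 + s * s' * k1 + (r * t' + r' * t) * pi ^+ a).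
rewrite -addnn exprD in E1.
split; first by ring.
  transitivity (r * r' * (pi ^+ a * x) + r * r' * (pi ^+ a * x)
    + (r * s' + r' * s) * pi ^+ a * pi ^+ b); first by ring.
  by rewrite -{2}Ew; ring.
transitivity (r * r' * (pi ^+ a * y + (x ^+ 2 - w * z)) + (r * s' + r' * s) * (x * pi ^+ b)
  + s * s' * (pi ^+ b * pi ^+ b) + (r * t' + r' * t) * pi ^+ a * pi ^+ c
  + r * r' * pi ^+ a * y + (r * r' * w + (r * s' + r' * s) * pi ^+ a) * z); first by ring.
by rewrite E1 E2 E3; ring.
Qed.

End Subalgebras.

(** * Counting the subalgebras of given index *)

Section Counting.
Local Open Scope ring_scope.

(** Extensionality of predicates turns the pointwise distinctness required by [subalg_count] into
    injectivity of L. *)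
Lemma subalg_count_map (R : idomainType) n m (T : eqType) (ts : seq T)
    (L : T -> 'rV[R]_n -> Prop) :
  uniq ts -> {in ts &, injective L} ->
  (forall t, t \in ts -> is_subalg (L t) /\ has_index (L t) m) ->
  (forall U, is_subalg U -> has_index U m -> exists2 t, t \in ts & U = L t) ->
  subalg_count R n m (size ts).
Proof.
move=> uts injL Lok Lex; exists [seq L t | t <- ts].
have nthL i : (i < size ts)%N -> exists t, [/\ t \in ts, index t ts = i &
    nth (fun=> False) [seq L t | t <- ts] i = L t].
  case: ts uts {injL Lok Lex} => // t0 s us ilt; exists (nth t0 (t0 :: s) i).
  by rewrite mem_nth // index_uniq // (nth_map t0).
split; first by rewrite size_map.
- by move=> i /nthL [t [tts _ ->]]; exact: Lok.
- move=> i j /nthL [t [tts <- ->]] /nthL [t' [tts' <- ->]] tt'.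
  apply: contrapT => /forallNP N; apply: tt'; congr index; apply: injL => //.
  by apply/funext => x; apply/propext; apply: contrapT; exact: N.
move=> U Us Ui; have [t tts ->] := Lex U Us Ui; exists (index t ts); first by rewrite index_mem.
by move=> x; rewrite (nth_map t) ?index_mem // nth_index.
Qed.

Variables (R : idomainType) (pi : R) (q : nat).
Hypotheses (pi_neq0 : pi != 0) (pi_nunit : pi \isn't a GRing.unit).
Hypothesis unif : forall x : R, x != 0 ->
  exists (u : R) (k : nat), u \is a GRing.unit /\ x = u * pi ^+ k.
Hypothesis res_card : residue_card pi q.

Let reps := pexp_reps res_card.

Lemma subalg_submod n (U : 'rV[R]_n -> Prop) : is_subalg U -> submod U.
Proof. by case. Qed.

Lemma subalg2_lattice m (U : 'rV[R]_2 -> Prop) : is_subalg U -> has_index U m ->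
  exists b c z, [/\ z \in reps c, dvdR (pi ^+ c) (pi ^+ b * z), U = lattice2 pi b c z
                  & m = (q ^ (b + c))%N].
Proof.
move=> Us Ui; have Um := subalg_submod Us.
have Uc := has_index_contains_pexp pi_neq0 pi_nunit unif Um Ui.
have [b [c [z [zc E]]]] := submod2_lattice pi_neq0 pi_nunit unif res_card Um Uc.
exists b, c, z; split=> //; first by apply/(lattice2_subalg pi_neq0); rewrite -E.
have tr := lattice2_transversal pi_neq0 pi_nunit res_card b c z.
rewrite E in Um Ui; rewrite (has_index_uniq Um Ui tr) !size_ext_reps muln1.
by rewrite expnD.
Qed.

Lemma subalg3_lattice m (U : 'rV[R]_3 -> Prop) : is_subalg U -> has_index U m ->
  exists a b c x z y, [/\ [/\ x \in reps b, z \in reps c & y \in reps c],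
    subalg3_cond pi a b c x z y, U = lattice3 pi a b c x z y & m = (q ^ (a + b + c))%N].
Proof.
move=> Us Ui; have Um := subalg_submod Us.
have Uc := has_index_contains_pexp pi_neq0 pi_nunit unif Um Ui.
have [a [b [c [x [z [y [xb zc yc E]]]]]]] := submod3_lattice pi_neq0 pi_nunit unif res_card Um Uc.
exists a, b, c, x, z, y; split=> //; first by apply/(lattice3_subalg pi_neq0); rewrite -E.
have tr := lattice3_transversal pi_neq0 pi_nunit res_card a b c x z y.
rewrite E in Um Ui; rewrite (has_index_uniq Um Ui tr) !size_ext_reps muln1.
by rewrite -addnA !expnD.
Qed.

Lemma reps_uniq k : uniq (reps k).
Proof.
exact: transversal_uniq (pdvd_subgroup pi k) (pexp_reps_transversal pi_neq0 pi_nunit res_card k).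
Qed.

Definition fiber2 (b c : nat) : seq R :=
  [seq z <- reps c | `[< dvdR (pi ^+ c) (pi ^+ b * z) >]].

(** The pair is (c, b), in the order of the sums in [sum_by_total2], whose indices b and a they
    are. *)
Definition exps2 k : seq ('I_k.+1 * 'I_k.+1) :=
  filter (fun e : 'I_k.+1 * 'I_k.+1 => e.2 + e.1 == k)%N (enum predT).

Definition params2 k : seq ('I_k.+1 * 'I_k.+1 * R) :=
  [seq (e, z) | e : 'I_k.+1 * 'I_k.+1 <- exps2 k,
                z : R <- fiber2 e.2 e.1].

Lemma subalg2_count k :
  subalg_count R 2 (q ^ k) (sum_by_total2 (fun a b => q ^ minn a b)%N k).
Proof.
have -> : sum_by_total2 (fun a b => q ^ minn a b)%N k = size (params2 k).
  rewrite size_allpairs_dep sumnE big_map big_filter big_enum_cond /= /sum_by_total2.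
  rewrite pair_big_dep /=; apply: eq_bigr => e _.
  by rewrite size_filter (num_subalg2E pi_neq0 pi_nunit res_card).
pose L (t : 'I_k.+1 * 'I_k.+1 * R) := lattice2 pi t.1.2 t.1.1 t.2.
apply: (subalg_count_map (L := L)).
- apply: allpairs_uniq_dep => [|e _|[e z] [e' z'] _ _ [-> ->] //].
    by rewrite filter_uniq // enum_uniq.
  by rewrite filter_uniq // reps_uniq.
- move=> _ _ /allpairsPdep [e [z [_ ze ->]]] /allpairsPdep [e' [z' [_ ze' ->]]].
  move: ze ze'; rewrite !mem_filter => /andP[_ ze] /andP[_ ze'].
  move/(lattice2_inj pi_neq0 pi_nunit ze ze') => [/= E1 E2 ->].
  case: e e' E1 E2 {ze ze'} => [c b] [c' b'] /= /val_inj -> /val_inj -> //.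
- move=> _ /allpairsPdep [e [z [es ze ->]]]; rewrite /L /=.
  move: es ze; rewrite !mem_filter => /andP[/eqP ek _] /andP[/asboolP dz _].
  split; first exact/(lattice2_subalg pi_neq0).
  by rewrite -[X in (q ^ X)%N]ek; exact: lattice2_index.
move=> U Us Ui; have [b [c [z [zc dz -> E]]]] := subalg2_lattice Us Ui.
(* Since q > 1, the index q^k determines k. *)
have bck : (b + c)%N = k by apply/esym/(expnI (residue_card_gt1 pi_neq0 pi_nunit res_card)).
have [bk ck] : (b < k.+1)%N /\ (c < k.+1)%N by rewrite -bck !ltnS leq_addr leq_addl.
exists ((Ordinal ck, Ordinal bk), z) => //.
apply/allpairsPdep; exists (Ordinal ck, Ordinal bk), z; split=> //.
  by rewrite mem_filter /= bck eqxx mem_enum.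
by rewrite mem_filter /= zc andbT; apply/asboolP.
Qed.

Definition fiber3 (a b c : nat) : seq (R * (R * R)) :=
  [seq u <- [seq (x, v) | x <- reps b, v <- [seq (z, y) | z <- reps c, y <- reps c]]
     | `[< subalg3_cond pi a b c u.1 u.2.1 u.2.2 >]].

Lemma size_fiber3 a b c : size (fiber3 a b c) = zeta3_count q a b c.
Proof.
rewrite -(num_subalg3E pi_neq0 pi_nunit unif res_card) size_filter -sum1_count big_mkcond.
rewrite big_allpairs_dep; apply: eq_bigr => x _; rewrite big_allpairs_dep.
by apply: eq_bigr => z _; rewrite -sum1_count [RHS]big_mkcond.
Qed.

(** The entries are (c, (b, a)), following the nesting of the sums in [sum_by_total3]. *)
Definition exps3 k : seq ('I_k.+1 * ('I_k.+1 * 'I_k.+1)) :=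
  filter (fun e : 'I_k.+1 * ('I_k.+1 * 'I_k.+1) => e.2.2 + e.2.1 + e.1 == k)%N (enum predT).

Definition params3 k : seq ('I_k.+1 * ('I_k.+1 * 'I_k.+1) * (R * (R * R))) :=
  [seq (e, u) | e : 'I_k.+1 * ('I_k.+1 * 'I_k.+1) <- exps3 k,
                u : R * (R * R) <- fiber3 e.2.2 e.2.1 e.1].

Lemma mem_fiber3 a b c u : u \in fiber3 a b c <->
  [/\ u.1 \in reps b, u.2.1 \in reps c, u.2.2 \in reps c & subalg3_cond pi a b c u.1 u.2.1 u.2.2].
Proof.
rewrite mem_filter; split=> [/andP[/asboolP C]|[xb zc yc C]].
  by case/allpairsP => -[x v] [/= xb /allpairsP [[z y] [/= zc yc ->]] E]; rewrite E /= in C *.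
apply/andP; split; first exact/asboolP.
by apply/allpairsP; exists u; rewrite -!surjective_pairing; split=> //; apply/allpairsP; exists u.2; rewrite -surjective_pairing.
Qed.

Lemma subalg3_count k :
  subalg_count R 3 (q ^ k) (sum_by_total3 (zeta3_count q) k).
Proof.
have -> : sum_by_total3 (zeta3_count q) k = size (params3 k).
  rewrite size_allpairs_dep sumnE big_map big_filter big_enum_cond /= /sum_by_total3.
  transitivity (\sum_(c < k.+1) \sum_(p : 'I_k.+1 * 'I_k.+1 | p.2 + p.1 + c == k)
      zeta3_count q p.2 p.1 c)%N.
    by apply: eq_bigr => c _; rewrite pair_big_dep.
  rewrite pair_big_dep /=; apply: eq_bigr => e _.
  by rewrite size_fiber3.
pose L (t : 'I_k.+1 * ('I_k.+1 * 'I_k.+1) * (R * (R * R))) :=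
  lattice3 pi t.1.2.2 t.1.2.1 t.1.1 t.2.1 t.2.2.1 t.2.2.2.
apply: (subalg_count_map (L := L)).
- apply: allpairs_uniq_dep => [|e _|[e z] [e' z'] _ _ [-> ->] //].
    by rewrite filter_uniq // enum_uniq.
  rewrite filter_uniq // allpairs_uniq ?reps_uniq //; last by move=> [? ?] [? ?] _ _ [-> ->].
  by rewrite allpairs_uniq ?reps_uniq // => -[? ?] [? ?] _ _ [-> ->].
- move=> _ _ /allpairsPdep [e [u [_ /mem_fiber3 [xb zc yc _] ->]]]
    /allpairsPdep [e' [u' [_ /mem_fiber3 [xb' zc' yc' _] ->]]].
  case/(lattice3_inj pi_neq0 pi_nunit xb zc yc xb' zc' yc') => /=.
  move: e e' u u' {xb zc yc xb' zc' yc'} => [c [b a]] [c' [b' a']] [x [z y]] [x' [z' y']] /=.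
  by case=> /val_inj -> /val_inj -> /val_inj -> [-> -> ->].
- move=> _ /allpairsPdep [e [u [es /mem_fiber3 [_ _ _ C] ->]]]; rewrite /L /=.
  move: es; rewrite mem_filter => /andP[/eqP ek _].
  split; first exact/(lattice3_subalg pi_neq0).
  by rewrite -[X in (q ^ X)%N]ek; exact: lattice3_index.
move=> U Us Ui; have [a [b [c [x [z [y [[xb zc yc] C -> E]]]]]]] := subalg3_lattice Us Ui.
have abck : (a + b + c)%N = k by apply/esym/(expnI (residue_card_gt1 pi_neq0 pi_nunit res_card)).
have [ak bk ck] : [/\ (a < k.+1)%N, (b < k.+1)%N & (c < k.+1)%N] by rewrite -abck; split; lia.
pose e := (Ordinal ck, (Ordinal bk, Ordinal ak)).
exists (e, (x, (z, y))) => //; apply/allpairsPdep; exists e, (x, (z, y)); split=> //.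
  by rewrite mem_filter /= abck eqxx mem_enum.
exact/mem_fiber3.
Qed.

Lemma subalg_count0 n m : (forall U : 'rV[R]_n -> Prop, is_subalg U -> ~ has_index U m) ->
  subalg_count R n m 0.
Proof. by move=> H; exists [::]; split=> // U Us /(H U Us). Qed.

Lemma zeta_identity2 : zeta_identity R 2 q (P2 q) (Q2 q).
Proof.
exists (sum_by_total2 (fun a b => q ^ minn a b)%N); split.
- exact: subalg2_count.
- move=> m mq; apply: subalg_count0 => U Us Ui.
  by have [b [c [z [_ _ _]]]] := subalg2_lattice Us Ui; exact: mq.
- exact: zeta2_coef.
Qed.

Lemma zeta_identity3 : zeta_identity R 3 q (P3 q) (Q3 q).
Proof.
exists (sum_by_total3 (zeta3_count q)); split.
- exact: subalg3_count.
- move=> m mq; apply: subalg_count0 => U Us Ui.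
  by have [a [b [c [x [z [y [_ _ _]]]]]]] := subalg3_lattice Us Ui; exact: mq.
- by apply: zeta3_coef; exact: ltnW (residue_card_gt1 pi_neq0 pi_nunit res_card).
Qed.

End Counting.

Theorem mainTheorem10 :
  exists N0 : nat, forall p : nat, prime p -> (N0 < p)%N ->
  forall (R : idomainType) (pi : R) (q : nat),
    is_padic_int_ring p pi -> residue_card pi q ->
    zeta_identity R 2 q (P2 q) (Q2 q) /\ zeta_identity R 3 q (P3 q) (Q3 q).
Proof.
exists 0%N => p _ _ R pi q [[pi_neq0 pi_nunit] unif _ _ _] res_card.
split; first exact: zeta_identity2 pi_neq0 pi_nunit unif res_card.
exact: zeta_identity3 pi_neq0 pi_nunit unif res_card.
Qed.
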